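(* Let $G$ be a $\sigma$-compact, locally compact amenable group and let $\{\alpha_n\}_{n\in\mathbb{N}}$ be a sequence of continuous isometric actions of $G$ on compact metric spaces $(X_n,d_n)$. Assume that $\lim_{n\to\infty}d_{GH}(\alpha_n,\alpha)=0$ for some action $\alpha$ of $G$ on a compact metric space $(X,d)$. If $\alpha$ is uniquely ergodic, then $\lim_{n\to\infty}\operatorname{diam}(P_p^G(X_n))=0$ for every $p\ge 1$.
   Context: For an action $\alpha$ write $\alpha_g$ for the map given by $g\in G$; the action is isometric if every $\alpha_g$ is an isometry, and uniquely ergodic if there is exactly one Borel probability measure $\mu$ on $X$ with $(\alpha_g)_*\mu=\mu$ for all $g\in G$. Amenable: a locally compact group $G$ with left Haar measure $\lambda$ is amenable if for every compact $K\subset G$ and $\varepsilon>0$ there is a Borel set $F\subset G$ with $0<\lambda(F)<\infty$ and $\lambda(gF\Delta F)/\lambda(F)<\varepsilon$ for every $g\in K$. For a compact metric space $(X,d)$, $P_p(X)$ is the set of all Borel probability measures on $X$ with the Wasserstein metric $W_p(\mu,\nu)=\left(\inf_{\pi}\int_{X\times X}d(x_1,x_2)^p\,d\pi(x_1,x_2)\right)^{1/p}$, where $\pi$ ranges over all Borel probability measures on $X\times X$ with marginals $\mu$ and $\nu$. $P_p^G(X_n)$ is the set of $\alpha_n$-invariant measures in $P_p(X_n)$, and its diameter is taken with respect to $W_p$. An $\varepsilon$-isometry $f:(X,d_X)\to(Y,d_Y)$ is a map (not necessarily continuous) with $|d_Y(f(x_1),f(x_2))-d_X(x_1,x_2)|\le\varepsilon$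 for all $x_1,x_2\in X$ and such that every $y\in Y$ satisfies $d_Y(y,f(x))\le\varepsilon$ for some $x\in X$. For actions $\alpha,\beta$ of $G$ on metric spaces $X,Y$, an $\varepsilon$-GHA from $\alpha$ to $\beta$ is an $\varepsilon$-isometry $f:X\to Y$ with $\sup_{x\in X}d_Y(\beta_g(f(x)),f(\alpha_g(x)))\le\varepsilon$ for every $g\in G$. The distance $d_{GH}(\alpha,\beta)$ is the infimum of the $\varepsilon>0$ for which there exist both an $\varepsilon$-GHA from $\alpha$ to $\beta$ and an $\varepsilon$-GHA from $\beta$ to $\alpha$ (with $\inf\varnothing=+\infty$). *)

(* Defs.v *)
From HB Require Import structures.
From mathcomp Require Import all_boot all_order all_algebra.
From mathcomp Require Import all_classical all_reals all_analysis.
Set Implicit Arguments.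
Unset Strict Implicit.
Unset Printing Implicit Defensive.
Import Order.TTheory GRing.Theory Num.Theory.

Local Open Scope classical_set_scope.
Local Open Scope ring_scope.

(* Measurable types are pointed in MathComp-Analysis, hence the spaces that
   carry Borel measures below are pointed too; the base point plays no role. *)

HB.mixin Record Group_isTopological G of Topological G & Group G := {
  continuous_mulg : continuous (fun xy : G * G => (xy.1 * xy.2)%g);
  continuous_invg : continuous (fun x : G => (x^-1)%g)
}.

#[short(type="topologicalGroupType")]
HB.structure Definition TopologicalGroup :=
  {G of Pointed G & Topological G & Group G & Group_isTopological G}.

#[short(type="pmetricType")]
HB.structure Definition PointedMetric (R : numDomainType) :=
  {X of Pointed X & Metric R X}.

Notation borel T := (g_sigma_algebraType (@open T)).

Section groups.
Variables (R : realType) (G : topologicalGroupType).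

Definition locally_compact_group : Prop :=
  hausdorff_space G /\ locally_compact [set: G].

Definition sigma_compact : Prop :=
  exists K : nat -> set G, (forall n, compact (K n)) /\ \bigcup_n K n = setT.

Definition ltranslate (g : G) (A : set G) : set G :=
  [set (g * h)%g | h in A].

(* A nonzero left-invariant Radon measure. *)
Definition left_haar (lambda : {measure set (borel G) -> \bar R}) : Prop :=
  [/\ (0 < lambda setT)%E,
      forall (g : G) (A : set (borel G)), measurable A ->
        lambda (ltranslate g A) = lambda A,
      forall K : set G, compact K -> (lambda K < +oo)%E,
      forall A : set (borel G), measurable A ->
        lambda A = ereal_inf [set lambda U | U in [set U : set G | open U /\ A `<=` U]] &
      forall U : set G, open U ->
        lambda U = ereal_sup [set lambda K | K in [set K : set G | compact K /\ K `<=` U]]].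

(* Haar measure being unique up to scaling, and the condition below being
   invariant under scaling, the choice of lambda is irrelevant. *)
Definition amenable : Prop :=
  exists lambda : {measure set (borel G) -> \bar R}, left_haar lambda /\
    forall (K : set G) (eps : R), compact K -> 0 < eps ->
      exists F : set (borel G),
        [/\ measurable F, (0 < lambda F)%E, (lambda F < +oo)%E &
            forall g, K g ->
              (lambda (ltranslate g F `+` F) / lambda F < eps%:E)%E].

End groups.

Section actions.
Variables (R : realType) (G : topologicalGroupType).

Definition is_action (X : Type) (alpha : G -> X -> X) : Prop :=
  (forall x, alpha 1%g x = x) /\
  (forall g h x, alpha (g * h)%g x = alpha g (alpha h x)).

Definition continuous_action (X : topologicalType) (alpha : G -> X -> X) : Prop :=
  is_action alpha /\ continuous (fun gx : G * X => alpha gx.1 gx.2).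

Definition isometric (X : metricType R) (alpha : G -> X -> X) : Prop :=
  forall g x y, mdist (alpha g x) (alpha g y) = mdist x y.

Definition invariant_measure (X : pmetricType R) (alpha : G -> X -> X)
    (mu : probability (borel X) R) : Prop :=
  forall (g : G) (A : set (borel X)), measurable A ->
    pushforward mu (alpha g : borel X -> borel X) A = mu A.

(* Uniqueness is up to equality on Borel sets, as the values of a measure on
   non-measurable sets are unspecified. *)
Definition uniquely_ergodic (X : pmetricType R) (alpha : G -> X -> X) : Prop :=
  exists mu : probability (borel X) R, invariant_measure alpha mu /\
    forall nu : probability (borel X) R, invariant_measure alpha nu ->
      forall A : set (borel X), measurable A -> nu A = mu A.

Definition eps_isometry (X Y : metricType R) (eps : R) (f : X -> Y) : Prop :=
  (forall x1 x2, `|mdist (f x1) (f x2) - mdist x1 x2| <= eps) /\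
  (forall y, exists x, mdist y (f x) <= eps).

Definition GHA (X Y : metricType R) (eps : R)
    (alpha : G -> X -> X) (beta : G -> Y -> Y) (f : X -> Y) : Prop :=
  eps_isometry eps f /\
  forall g, (ereal_sup [set (mdist (beta g (f x)) (f (alpha g x)))%:E
                       | x in [set: X]] <= eps%:E)%E.

Definition dGH (X Y : metricType R)
    (alpha : G -> X -> X) (beta : G -> Y -> Y) : \bar R :=
  ereal_inf [set eps%:E | eps in [set eps : R |
    [/\ 0 < eps, exists f, GHA eps alpha beta f
               & exists f, GHA eps beta alpha f]]].

End actions.

Section wasserstein.
Variables (R : realType) (X : pmetricType R).

Definition coupling (mu nu : probability (borel X) R)
    (pi : probability (borel (X * X)%type) R) : Prop :=
  forall A : set (borel X), measurable A ->
    pi (fst @^-1` A) = mu A /\ pi (snd @^-1` A) = nu A.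

Definition wasserstein (p : R) (mu nu : probability (borel X) R) : \bar R :=
  ((ereal_inf [set (\int[pi]_x ((mdist x.1 x.2) `^ p)%:E)%E
              | pi in coupling mu nu]) `^ p^-1)%E.

(* The supremum is taken in [0, +oo], so that the empty set has diameter 0. *)
Definition wasserstein_diam (p : R) (S : set (probability (borel X) R)) : \bar R :=
  maxe 0%E (ereal_sup [set wasserstein p mn.1 mn.2 | mn in S `*` S]).

End wasserstein.

(* Main.v *)
Require Import Defs.
From HB Require Import structures.
From mathcomp Require Import all_boot all_order all_algebra.
From mathcomp Require Import all_classical all_reals all_analysis.
From mathcomp Require Import measurable_realfun.
From mathcomp Require Import finmap lra ring.

(** Why the diameters tend to zero. An isometric action on a compact space is as
    good as an action of a compact group, so its orbit closures partition the space
    and each of them carries an invariant probability measure. Unique ergodicity of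
    the limit action therefore means that all its orbits are dense. (The limit
    action is isometric, being approximated by isometric actions.) An approximation
    within [e] transports this to the approximating action, whose orbits are then
    [3 * e]-dense. What remains is that, when the orbits of an isometric action are
    [r]-dense, any two invariant measures are within [r] of each other for every
    Wasserstein distance.

    Invariant measures on orbit closures are built from covering numbers, after
    Haar: the ultralimit of the ratios of covering numbers at smaller and smaller
    scales is a content invariant under isometries and additive on separated sets,
    and the outer measure it generates restricts to the Borel sets
    ([exists_invariant_probability]). Two disjoint orbit closures would thus give
    two invariant measures ([uniquely_ergodic_dense]).

    For the comparison of two invariant measures [mu] and [nu], draw [x] from [mu]
    and [y] from [nu] independently, choose [k] in the group with [x] within [r] of
    [k y], and move the pair by a random group element [h] to [h x] and [h k y]. The
    distance stays at most [r], and if the law of [h] were invariant the two points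
    would still have laws [mu] and [nu]. The invariant law is replaced by finite
    means over the group that are nearly constant on finitely many almost periodic
    functions ([exists_nearly_constant_avgs]); these functions are the masses
    exchanged between the members of a Lipschitz partition of unity. A limit of the
    corresponding matrices is an exact coupling of the discretised measures
    ([averaged_coupling]), and it lifts to a coupling of [mu] and [nu] supported
    near the diagonal ([exists_weighted_coupling], [wasserstein_dense_orbits]). *)

Set Implicit Arguments.
Unset Strict Implicit.
Unset Printing Implicit Defensive.
Import Order.TTheory GRing.Theory Num.Theory.
Import numFieldNormedType.Exports.

Local Open Scope classical_set_scope.
Local Open Scope ring_scope.

(** * Limits along an ultrafilter *)

Section ultralimit.
Variable R : realType.
Implicit Types u v w : nat -> R.

(** A fixed ultrafilter containing the final segments of [nat]: along it every
    bounded real sequence converges, so that [ulim] is a linear, monotone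
    extension of the limit to all bounded sequences. *)
Definition ultra_oo : set_system nat :=
  sval (cid (ultraFilterLemma eventually_filter)).

Lemma ultra_oo_ultra : UltraFilter ultra_oo.
Proof. by rewrite /ultra_oo; case: cid => /= ? []. Qed.
#[local] Existing Instance ultra_oo_ultra.

Lemma ultra_oo_sub : \oo `<=` ultra_oo.
Proof. by rewrite /ultra_oo; case: cid => /= ? []. Qed.

Definition ulim u : R := lim (u @ ultra_oo).

Lemma ulimP u : (exists M, forall n, `|u n| <= M) -> u @ ultra_oo --> ulim u.
Proof.
move=> [M uM].
have := @segment_compact R (- M) M; rewrite compact_ultra => cM.
have uS : (u @ ultra_oo) `[- M, M]%classic.
  by apply: ultra_oo_sub; exists 0%N => // n _; rewrite /= in_itv /= -ler_norml.
have uU : UltraFilter (u @ ultra_oo).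
  split=> [|G GF uG]; first exact: fmap_proper_filter.
  apply/seteqP; split=> // A GA.
  have [//|uA] := in_ultra_setVsetC (u @^-1` A) ultra_oo_ultra.
  have : G (A `&` ~` A) by apply: filterI => //; exact: uG.
  by rewrite setICr => /filter_not_empty.
have [l [_ ul]] := cM _ uU uS; exact: (cvgP l ul).
Qed.

Lemma cvg_ulim u l : u @ \oo --> l -> ulim u = l.
Proof.
by move=> ul; apply: cvg_lim => //; apply: cvg_trans ul => A; exact: ultra_oo_sub.
Qed.

Lemma ulim_cst (c : R) : ulim (fun=> c) = c.
Proof. by apply: cvg_ulim; exact: cvg_cst. Qed.

Lemma ulimD u v : (exists M, forall n, `|u n| <= M) ->
  (exists M, forall n, `|v n| <= M) ->
  ulim (fun n => u n + v n) = ulim u + ulim v.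
Proof. by move=> /ulimP uu /ulimP vv; apply: cvg_lim => //; exact: cvgD. Qed.

Lemma ulim_sum (I : finType) (u : I -> nat -> R) :
  (forall i, exists M, forall n, `|u i n| <= M) ->
  ulim (fun n => \sum_i u i n) = \sum_i ulim (u i).
Proof.
move=> uM; apply: cvg_lim => //; elim: (index_enum I) => [|i s IHs].
  by under eq_fun do rewrite big_nil; rewrite big_nil; exact: cvg_cst.
under eq_fun do rewrite big_cons; rewrite big_cons.
by apply: cvgD IHs; exact: ulimP.
Qed.

Lemma le_ulim u v : (exists M, forall n, `|u n| <= M) ->
  (exists M, forall n, `|v n| <= M) ->
  (\forall n \near \oo, u n <= v n) -> ulim u <= ulim v.
Proof.
move=> /ulimP uu /ulimP vv /ultra_oo_sub uv.
by apply: ler_lim => //; apply: cvgP; eassumption.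
Qed.

End ultralimit.

(** * Covering numbers and the content they define *)

Section covering_number.
Variables (R : realType) (X : metricType R).
Implicit Types (A B Y : set X) (e : R).

(** A cover of [A] by at most [n] sets of diameter at most [e] is encoded as a
    colouring [c] of the space using the colours in [s]: the covering sets are
    the colour classes in [A]. Restricting a colouring to a smaller set or
    counting the colours seen by a subset is then immediate. *)
Definition covered e A (n : nat) := exists (c : X -> nat) (s : seq nat),
  [/\ (size s <= n)%N, forall x, A x -> c x \in s &
      forall x y, A x -> A y -> c x = c y -> mdist x y <= e].

(** The value is 0 by convention when [A] has no finite cover. *)
Definition covnum e A : nat :=
  if pselect (exists n, `[< covered e A n >]) is left h then ex_minn h else 0%N.

Definition totally_bounded := forall e, 0 < e -> exists n, covered e setT n.

Lemma covered_sub e A B n : A `<=` B -> covered e B n -> covered e A n.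
Proof.
move=> AB [c [s [sn cs ce]]]; exists c, s; split => // [x /AB|x y /AB Bx /AB By].
  exact: cs.
exact: ce.
Qed.

Lemma covnum_le e A n : covered e A n -> (covnum e A <= n)%N.
Proof.
move=> /asboolP An; rewrite /covnum; case: pselect => [h|]; last first.
  by case; exists n.
by case: ex_minnP => m _; apply.
Qed.

Lemma covnum0 e : covnum e set0 = 0%N.
Proof.
apply/eqP; rewrite -leqn0; apply: covnum_le.
by exists (fun=> 0%N), [::]; split.
Qed.

Hypothesis tbX : totally_bounded.

Lemma covered_covnum e A : 0 < e -> covered e A (covnum e A).
Proof.
move=> /tbX[n /covered_sub Xn]; rewrite /covnum; case: pselect => [h|[]].
  by case: ex_minnP => m /asboolP.
by exists n; apply/asboolP; exact: Xn.
Qed.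

Lemma covnum_mono e A B : 0 < e -> A `<=` B -> (covnum e A <= covnum e B)%N.
Proof.
by move=> e0 AB; apply/covnum_le/(covered_sub AB); exact: covered_covnum.
Qed.

Lemma covnum_gt0 e A : 0 < e -> A !=set0 -> (0 < covnum e A)%N.
Proof.
move=> e0 [x Ax]; have [c [s [sn cs _]]] := covered_covnum A e0.
by apply: leq_trans sn; case: s cs => // /(_ _ Ax).
Qed.

Lemma covnumU e A B : 0 < e ->
  (covnum e (A `|` B) <= covnum e A + covnum e B)%N.
Proof.
move=> e0; have [c [s [sn cs ce]]] := covered_covnum A e0.
have [d [t [tn dt de]]] := covered_covnum B e0.
apply: covnum_le.
exists (fun x => if `[< A x >] then (c x).*2 else (d x).*2.+1).
exists ([seq k.*2 | k <- s] ++ [seq k.*2.+1 | k <- t]); split.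
- by rewrite size_cat !size_map leq_add.
- move=> x ABx; rewrite mem_cat; case: asboolP => Ax.
    by rewrite map_f//; exact: cs.
  by rewrite orbC map_f//; apply: dt; case: ABx.
- move=> x y ABx ABy; case: asboolP => Ax; case: asboolP => Ay.
  + by move/double_inj => cxy; exact: ce.
  + by move/(congr1 odd); rewrite /= !odd_double.
  + by move/(congr1 odd); rewrite /= !odd_double.
  + by move=> /succn_inj/double_inj; apply: de; [case: ABx|case: ABy].
Qed.

(** No set of diameter at most [e] meets both [A] and [B], so the colours used
    on [A] and on [B] are disjoint. This is what makes the limit of normalised
    covering numbers additive on separated sets. *)
Lemma covnum_sep e A B : 0 < e ->
    (forall x y, A x -> B y -> e < mdist x y) ->
  (covnum e A + covnum e B <= covnum e (A `|` B))%N.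
Proof.
move=> e0 AB; have [c [s [sn cs ce]]] := covered_covnum (A `|` B) e0.
apply: leq_trans sn.
pose a := [pred k | `[< exists2 x, A x & c x = k >]].
pose b := [pred k | `[< exists2 x, B x & c x = k >]].
have Na : (covnum e A <= count a s)%N.
  apply: covnum_le; exists c, (seq.filter a s); split; rewrite ?size_filter//.
    move=> x Ax; rewrite mem_filter cs ?andbT; last by left.
    by apply/asboolP; exists x.
  by move=> x y Ax Ay; apply: ce; left.
have Nb : (covnum e B <= count b s)%N.
  apply: covnum_le; exists c, (seq.filter b s); split; rewrite ?size_filter//.
    move=> x Bx; rewrite mem_filter cs ?andbT; last by right.
    by apply/asboolP; exists x.
  by move=> x y Bx By; apply: ce; right.
apply: leq_trans (leq_add Na Nb) _; rewrite -count_predUI.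
rewrite [X in (_ + X)%N](_ : _ = 0%N) ?addn0 ?count_size//.
apply/eqP; rewrite -leqn0 leqNgt -has_count; apply/hasP => -[k _ /=].
move=> /andP[/asboolP[x Ax <-] /asboolP[y By cyx]].
have := AB x y Ax By; rewrite ltNge => /negP; apply.
by apply: ce => //; [left|right].
Qed.

Lemma covnum_preimage e A (g : X -> X) : 0 < e ->
    (forall x y, mdist (g x) (g y) = mdist x y) ->
  (covnum e (g @^-1` A) <= covnum e A)%N.
Proof.
move=> e0 gi; have [c [s [sn cs ce]]] := covered_covnum A e0.
apply: covnum_le; exists (c \o g), s; split => //= [x|x y] Ax; first exact: cs.
by move=> Ay cxy; rewrite -gi; exact: ce.
Qed.

End covering_number.

Section content.
Variables (R : realType) (X : metricType R).
Hypothesis tbX : totally_bounded X.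
Variable Y : set X.
Implicit Types (A B U V : set X).

Let e (n : nat) : R := n.+1%:R^-1.

Let e_gt0 n : 0 < e n. Proof. by rewrite invr_gt0. Qed.

(** Haar's trick: the proportion of an efficient cover of [Y] that is needed to
    cover [U]. It depends on the metric only, so isometries preserving [Y]
    preserve it. *)
Definition rel_covnum U (n : nat) : R :=
  (covnum (e n) (U `&` Y))%:R / (covnum (e n) Y)%:R.

Lemma rel_covnum_ge0 U n : 0 <= rel_covnum U n.
Proof. by rewrite divr_ge0. Qed.

Lemma rel_covnum_le1 U n : rel_covnum U n <= 1.
Proof.
rewrite /rel_covnum; have [->|Y0] := eqVneq (covnum (e n) Y) 0%N.
  by rewrite invr0 mulr0 ler01.
rewrite ler_pdivrMr ?ltr0n ?lt0n// mul1r ler_nat.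
by apply: covnum_mono => //; exact: subIsetr.
Qed.

Lemma rel_covnum_bnd U : exists M, forall n, `|rel_covnum U n| <= M.
Proof.
by exists 1 => n; rewrite ger0_norm ?rel_covnum_ge0 ?rel_covnum_le1.
Qed.

Lemma rel_covnumD_bnd U V :
  exists M, forall n, `|rel_covnum U n + rel_covnum V n| <= M.
Proof.
exists 2 => n; rewrite ger0_norm ?addr_ge0 ?rel_covnum_ge0//.
by have := rel_covnum_le1 U n; have := rel_covnum_le1 V n; lra.
Qed.

Definition content U : R := ulim (rel_covnum U).

Lemma content0 : content set0 = 0.
Proof.
rewrite /content (_ : rel_covnum set0 = fun=> 0) ?ulim_cst//.
by apply/funext => n; rewrite /rel_covnum set0I covnum0 mul0r.
Qed.

Lemma content_ge0 U : 0 <= content U.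
Proof.
rewrite -[0](ulim_cst 0); apply: le_ulim; [|exact: rel_covnum_bnd|].
  by exists 0 => _; rewrite normr0.
by apply: nearW => n; exact: rel_covnum_ge0.
Qed.

Lemma content_mono U V : U `<=` V -> content U <= content V.
Proof.
move=> UV; apply: le_ulim; [exact: rel_covnum_bnd|exact: rel_covnum_bnd|].
apply: nearW => n; apply: ler_wpM2r; rewrite ?invr_ge0//.
by rewrite ler_nat; apply: covnum_mono => //; exact: setSI.
Qed.

Lemma contentU U V : content (U `|` V) <= content U + content V.
Proof.
rewrite /content -ulimD; try exact: rel_covnum_bnd.
apply: le_ulim; [exact: rel_covnum_bnd|exact: rel_covnumD_bnd|].
apply: nearW => n; rewrite /rel_covnum -mulrDl; apply: ler_wpM2r.
  by rewrite invr_ge0.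
by rewrite -natrD ler_nat setIUl; exact: covnumU.
Qed.

Lemma content_bigsetU (U : nat -> set X) n :
  content (\big[setU/set0]_(i < n) U i) <= \sum_(i < n) content (U i).
Proof.
elim: n => [|n IHn]; first by rewrite !big_ord0 content0.
by rewrite !big_ord_recr/=; apply: le_trans (contentU _ _) _; rewrite lerD2r.
Qed.

(** As soon as the scale drops below [d], the relative covering numbers are
    superadditive on the pair. *)
Lemma content_sep d U V : 0 < d ->
    (forall x y, U x -> V y -> d <= mdist x y) ->
  content U + content V <= content (U `|` V).
Proof.
move=> d0 UV; rewrite /content -ulimD; try exact: rel_covnum_bnd.
apply: le_ulim; [exact: rel_covnumD_bnd|exact: rel_covnum_bnd|].
near=> n; rewrite /rel_covnum -mulrDl; apply: ler_wpM2r.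
  by rewrite invr_ge0.
rewrite -natrD ler_nat setIUl; apply: covnum_sep => // x y [Ux _] [Vy _].
apply: lt_le_trans (UV x y Ux Vy); near: n.
exact: (near_infty_natSinv_lt (PosNum d0)).
Unshelve. all: by end_near. Qed.

Lemma content_full U : Y !=set0 -> Y `<=` U -> content U = 1.
Proof.
move=> Y0 YU; rewrite /content (_ : rel_covnum U = fun=> 1) ?ulim_cst//.
apply/funext => n; rewrite /rel_covnum setIidr// divff//.
by rewrite pnatr_eq0 -lt0n; exact: covnum_gt0.
Qed.

Lemma content_preimage (g : X -> X) U :
    (forall x y, mdist (g x) (g y) = mdist x y) -> (g @^-1` Y = Y) ->
  content (g @^-1` U) <= content U.
Proof.
move=> gi gY; apply: le_ulim; [exact: rel_covnum_bnd|exact: rel_covnum_bnd|].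
apply: nearW => n; apply: ler_wpM2r; rewrite ?invr_ge0//.
by rewrite ler_nat -{1}gY -preimage_setI; exact: covnum_preimage.
Qed.

End content.

(** * Compact metric spaces *)

Section metric.
Variables (R : realType) (X : metricType R).

Lemma mdist_quadrangle (a a' b b' : X) :
  `|mdist a b - mdist a' b'| <= mdist a a' + mdist b b'.
Proof.
rewrite ler_norml; apply/andP; split.
  have := metric_triangle a' a b'; have := metric_triangle a b b'.
  by rewrite (metric_sym a' a); lra.
have := metric_triangle a a' b; have := metric_triangle a' b' b.
by rewrite (metric_sym b' b); lra.
Qed.

Lemma openP (O : set X) :
  open O <-> forall x, O x -> exists2 e : R, 0 < e & forall y, mdist x y < e -> O y.
Proof.
rewrite openE; split=> OP x Ox.
  have [e /= e0 xO] := (metricType_numDomainType.nbhs_mdistP _ _).1 (OP _ Ox).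
  by exists e.
by apply/metricType_numDomainType.nbhs_mdistP; have [e e0 xO] := OP _ Ox; exists e.
Qed.

Lemma mdist_ball_open (x : X) (e : R) : open (ball x e).
Proof.
apply/openP => y; rewrite ballEmdist /= => xy.
exists (e - mdist x y); rewrite ?subr_gt0// => z yz.
by have := metric_triangle x y z; lra.
Qed.

End metric.

Section compact_metric.
Variables (R : realType) (X : pmetricType R).
Hypothesis cX : compact [set: X].
Implicit Types (A B O : set X) (e : R).

Lemma compact_net e : 0 < e ->
  exists s : seq X, forall x, exists2 y, y \in s & mdist y x < e.
Proof.
move=> e0; have : cover_compact [set: X] by rewrite -compact_cover.
move=> /(_ X setT (fun x => ball x e))[||D _ DX].
- by move=> x _; exact: mdist_ball_open.
- by move=> x _; exists x => //; exact: ballxx.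
exists (enum_fset D) => x; have [y /= yD] := DX x I.
by rewrite ballEmdist; exists y.
Qed.

Lemma compact_totally_bounded : totally_bounded X.
Proof.
move=> e e0; have [s sX] := compact_net (divr_gt0 e0 (ltr0n R 2)).
exists (size s), (fun x => find (fun y => mdist y x < e / 2) s), (iota 0 (size s)).
have has_s x : has (fun y => mdist y x < e / 2) s.
  by apply/hasP; have [y ys yx] := sX x; exists y.
split=> [|x _|x y _ _ xy]; first by rewrite size_iota.
  by rewrite mem_iota add0n /= -has_find.
have := nth_find point (has_s x); have := nth_find point (has_s y).
rewrite xy; set z := nth _ _ _ => zy zx.
have := metric_triangle x z y; rewrite (metric_sym x z); lra.
Qed.

Lemma compact_dense_seq (a : nat -> R) : (forall n, 0 < a n) ->
  exists c : nat -> nat -> X, forall n x, exists i, mdist (c n i) x < a n.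
Proof.
move=> a_gt0; pose s n := sval (cid (compact_net (a_gt0 n))).
exists (fun n => nth point (s n)) => n x.
have [y ys yx] := svalP (cid (compact_net (a_gt0 n))) x.
by exists (index y (s n)); rewrite nth_index.
Qed.

End compact_metric.

Lemma harmonic_lt (R : realType) (e : R) : 0 < e -> exists n, harmonic n < e.
Proof.
move=> e0; have [n _ nP] := near_infty_natSinv_lt (PosNum e0).
by exists n; exact: (nP n (leqnn n)).
Qed.

Section ball_basis.
Variables (R : realType) (X : pmetricType R).
Variables (a : nat -> R) (c : nat -> nat -> X).
Hypothesis a_small : forall e, 0 < e -> exists n, a n < e.
Hypothesis c_dense : forall n x, exists i, mdist (c n i) x < a n.

Let B n i : set X := ball (c n i) (a n).

(** The balls of radii [a n] about the points [c n i] form a countable base. *)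
Lemma open_bigcup_ball (O : set X) : open O ->
  O = \bigcup_n \bigcup_i (if `[< B n i `<=` O >] then B n i else set0).
Proof.
move=> oO; apply/seteqP; split=> [x Ox|x [n _ [i _]]]; last first.
  by case: asboolP => // BO /BO.
have [e e0 eO] := (openP O).1 oO x Ox.
have [|n ne] := a_small (e := e / 2); first by rewrite divr_gt0.
have [i ix] := c_dense n x.
exists n => //; exists i => //; case: asboolP => [_|[]].
  by rewrite /B ballEmdist.
move=> y; rewrite /B ballEmdist /= => iy; apply: eO.
have := metric_triangle x (c n i) y; rewrite (metric_sym x (c n i)); lra.
Qed.

Lemma openX_bigcup_ball (O : set (X * X)) : open O ->
  O = \bigcup_n \bigcup_i \bigcup_j
    (if `[< B n i `*` B n j `<=` O >] then B n i `*` B n j else set0).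
Proof.
move=> oO; apply/seteqP; split=> [[x y] Oxy|x [n _ [i _ [j _]]]]; last first.
  by case: asboolP => // BO /BO.
have : nbhs (x, y) O by exact: open_nbhs_nbhs.
rewrite -nbhs_ballE => -[e /= e0 eO].
have [|n ne] := a_small (e := e / 2); first by rewrite divr_gt0.
have [i ix] := c_dense n x; have [j jy] := c_dense n y.
exists n => //; exists i => //; exists j => //; case: asboolP => [_|[]].
  by split; rewrite /B ballEmdist.
move=> -[x' y'] []; rewrite /B !ballEmdist /= => ix' jy'; apply: eO.
split; rewrite /= ballEmdist /=.
  have := metric_triangle x (c n i) x'; rewrite (metric_sym x (c n i)); lra.
have := metric_triangle y (c n j) y'; rewrite (metric_sym y (c n j)); lra.
Qed.

End ball_basis.

(** * Caratheodory's criterion for metric outer measures *)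

Section metric_outer_measure.
Variables (R : realType) (X : metricType R).
Variable mu : {outer_measure set X -> \bar R}.
Hypothesis mu_fin : (mu setT < +oo)%E.
Hypothesis mu_metric : forall (A B : set X) (d : R), 0 < d ->
  (forall x y, A x -> B y -> d <= mdist x y) ->
  (mu A + mu B <= mu (A `|` B))%E.
Variable f : X -> R.
Hypothesis f_lip : forall x y, f x - f y <= mdist x y.

Local Open Scope ereal_scope.

(** Split [A] by the level sets of [f]. The layers [D n], taken two apart, are at
    positive distance, so additivity on separated sets bounds the sum of their
    measures by twice the measure of [A]; the tail of that series is thus small,
    which says that [A `&` [set x | 0 < f x]] is exhausted in measure by its
    parts [C n] where [f] is bounded away from 0. Those parts are separated
    from the points of [A] where [f] is not positive. *)
Lemma metric_outer_measure_caratheodory : mu.-caratheodory [set x | 0 < f x]%R.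
Proof.
apply: le_caratheodory_measurable => A.
pose a n : R := (n.+1%:R^-1)%R.
have a_gt0 n : (0 < a n)%R by rewrite invr_gt0.
have aS n : (a n.+1 < a n)%R by rewrite ltf_pV2 ?posrE ?ltr0n// ltr_nat.
pose C n := A `&` [set x | a n < f x]%R.
pose D n := A `&` [set x | a n.+2 < f x <= a n.+1]%R.
have fin B : mu B \is a fin_num.
  rewrite ge0_fin_numE ?outer_measure_ge0//; apply: le_lt_trans mu_fin.
  exact: le_outer_measure.
have CD n : mu (C n) + mu (D n) <= mu (C n.+2).
  have d0 : (0 < a n - a n.+1)%R by rewrite subr_gt0.
  apply: le_trans (mu_metric d0 _) _.
    move=> x y [_ /= ax] [_ /andP[_ ay]].
    by apply: le_trans (f_lip x y); apply: lerB => //; exact: ltW.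
  apply: le_outer_measure => x [[Ax /= ax]|[Ax /= /andP[ax _]]]; split => //=.
  by apply: lt_trans ax; apply: lt_trans (aS _) (aS _).
have sumD n : \sum_(0 <= k < n) mu (D k) <= mu (C n) + mu (C n.+1).
  elim: n => [|n IHn]; first by rewrite big_nil adde_ge0// outer_measure_ge0.
  rewrite big_nat_recr//=; apply: le_trans (leeD2r _ IHn) _.
  (* the layer n is separated from C n and lies with it in C n.+2 *)
  by rewrite addeAC addeC leeD2l.
have cvgD : \sum_(0 <= k <oo) mu (D k) < +oo.
  apply: (@le_lt_trans _ _ (mu A + mu A)); last by rewrite ltey_eq fin_numD !fin.
  apply: lime_le; first by apply: is_cvg_nneseries => *; exact: outer_measure_ge0.
  apply: nearW => n; apply: le_trans (sumD n) _.
  by apply: leeD; apply: le_outer_measure => x [].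
have tail : \sum_(n <= k <oo) mu (D k) @[n --> \oo] --> 0.
  by apply: nneseries_tail_cvg => // k _; exact: outer_measure_ge0.
apply/lee_addgt0Pr => e e0.
have /tail[n _ /(_ n (leqnn n)) /= tn] : nbhs (0 : \bar R) [set z | z < e%:E].
  by apply: open_ereal_lt'; rewrite lte_fin.
have up : mu (A `&` [set x | 0 < f x]%R) <= mu (C n.+1) + e%:E.
  apply: (@le_trans _ _ (mu (C n.+1 `|` \bigcup_(k in ~` `I_n) D k))).
    apply: le_outer_measure => x [Ax /= fx].
    have [ax|ax] := ltP (a n.+1) (f x); first by left.
    (* the layer of x is read off the least k with a k < f x *)
    right; pose P k := (a k < f x)%R.
    have exP : exists k, P k.
      have [k _ /(_ k (leqnn k))] := near_infty_natSinv_lt (PosNum fx).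
      by exists k.
    case: (ex_minnP exP) => k Pk minP.
    have nk : (n.+1 < k)%N.
      rewrite ltnNge; apply/negP => kn; move: Pk; rewrite /P ltNge => /negP; apply.
      by apply: le_trans ax _; rewrite lef_pV2 ?posrE ?ltr0n// ler_nat.
    case: k Pk minP nk => [//|[//|k]] Pk minP nk.
    exists k => /=; first by apply/negP; rewrite -leqNgt.
    split => //=; rewrite [X in X && _]Pk /= leNgt; apply/negP => /minP.
    by rewrite ltnn.
  apply: le_trans (outer_measureU2 _ _ _) _; apply: leeD2l.
  apply: le_trans (ltW tn); exact: outer_measure_sigma_subadditive_tail.
have down : mu (C n.+1) + mu (A `&` ~` [set x | 0 < f x]%R) <= mu A.
  apply: le_trans (mu_metric (a_gt0 n.+1) _) _.
    move=> x y [_ /= ax] [_ /= /negP]; rewrite -leNgt => fy.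
    by apply: le_trans (f_lip x y); move: ax fy; clear; lra.
  by apply: le_outer_measure => x [[]|[]].
apply: le_trans (leeD2r _ up) _.
by rewrite addeAC leeD2r.
Qed.

End metric_outer_measure.

(** * Isometry-invariant measures *)

Section measure_of_content.
Variables (R : realType) (X : pmetricType R).
Hypothesis cX : compact [set: X].
Variable Y : set X.
Hypotheses (cY : compact Y) (Y0 : Y !=set0).

Let tbX := compact_totally_bounded cX.

Local Notation tau := (content Y).

(** The value [+oo] off the open sets forces the covers in [mu_ext] to be open,
    which is what compactness arguments require. *)
Definition open_content (U : set (borel X)) : \bar R :=
  if `[< open (U : set X) >] then (tau U)%:E else +oo%E.

Local Notation mu := (mu_ext open_content).

Local Open Scope ereal_scope.

Lemma open_content_ge0 U : 0 <= open_content U.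
Proof.
by rewrite /open_content; case: asboolP => // _; rewrite lee_fin content_ge0.
Qed.

Lemma open_contentE (U : set X) : open U -> open_content U = (tau U)%:E.
Proof. by rewrite /open_content; case: asboolP. Qed.

Lemma open_measurable_borel (U : set X) : open U -> measurable (U : set (borel X)).
Proof. by move=> oU; apply: sub_gen_smallest. Qed.

Lemma mu_ext_le (A : set X) (F : nat -> set X) : (forall k, open (F k)) ->
  A `<=` \bigcup_k F k -> mu A <= \sum_(k <oo) (tau (F k))%:E.
Proof.
move=> oF AF; apply: ereal_inf_lbound; exists F.
  by split=> // k; exact: open_measurable_borel.
by apply: eq_eseriesr => k _; rewrite open_contentE.
Qed.

Lemma mu_ext_ge (A : set X) x :
  (forall F : nat -> set X, (forall k, open (F k)) -> A `<=` \bigcup_k F k ->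
    x <= \sum_(k <oo) (tau (F k))%:E) -> x <= mu A.
Proof.
move=> AF; apply: le_ereal_inf_tmp => _ [F [_ cF] <-].
have [oF|] := pselect (forall k, open (F k : set X)).
  rewrite (eq_eseriesr (g := fun k => (tau (F k))%:E)); first exact: AF.
  by move=> k _; rewrite open_contentE.
move=> /existsNP[k oFk]; rewrite (@eseries_pinfty _ _ xpredT k) ?leey//.
  by move=> n _; rewrite gt_eqF// (lt_le_trans _ (open_content_ge0 _)) ?ltNy0.
by rewrite /open_content; case: asboolP.
Qed.

(** Shrinking each member of a cover of [A `|` B] to thin neighbourhoods of [A]
    and of [B] produces covers of [A] and of [B] that are separated, member by
    member. *)
Lemma mu_ext_metric (A B : set X) (d : R) : (0 < d)%R ->
  (forall x y, A x -> B y -> (d <= mdist x y)%R) ->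
  mu A + mu B <= mu (A `|` B).
Proof.
move=> d0 AB; apply: mu_ext_ge => F oF ABF.
have d3 : (0 < d / 3)%R by rewrite divr_gt0.
pose nb (C : set X) := \bigcup_(x in C) ball x (d / 3).
have onb C : open (nb C) by apply: bigcup_open => x _; exact: mdist_ball_open.
have nbC C k x : C x -> F k x -> (F k `&` nb C) x.
  by move=> Cx Fx; split => //; exists x => //; exact: ballxx.
have oFC C k : open (F k `&` nb C) by exact: openI.
apply: (@le_trans _ _ (\sum_(k <oo) (tau (F k `&` nb A))%:E
                     + \sum_(k <oo) (tau (F k `&` nb B))%:E)).
  apply: leeD; apply: mu_ext_le => // x Cx.
    by have [k _ Fx] := ABF x (or_introl Cx); exists k => //; exact: nbC.
  by have [k _ Fx] := ABF x (or_intror Cx); exists k => //; exact: nbC.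
rewrite -nneseriesD; [|by move=> *; rewrite lee_fin content_ge0..].
apply: lee_nneseries => [k _ _|k _].
  by rewrite adde_ge0// lee_fin content_ge0.
rewrite -EFinD lee_fin.
apply: (@le_trans _ _ (tau ((F k `&` nb A) `|` (F k `&` nb B)))).
  apply: (content_sep tbX _ d3) => x y [_ [a Aa]] + [_ [b Bb]].
  rewrite !ballEmdist /= => ax byy; have := AB a b Aa Bb.
  have := metric_triangle a x b; have := metric_triangle x y b.
  by rewrite (metric_sym y b); move: ax byy; clear; lra.
by apply: content_mono => // x [[]|[]].
Qed.

(** A finite subcover of [Y] already has total content at least that of [Y]. *)
Lemma mu_ext_compact : 1 <= mu Y.
Proof.
apply: mu_ext_ge => F oF YF.
have : cover_compact Y by rewrite -compact_cover.
move=> /(_ nat setT F)[//|//|D _ YD].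
pose n := (\max_(i <- enum_fset D) i).+1%N.
apply: (@le_trans _ _ (\sum_(0 <= k < n) (tau (F k))%:E)); last first.
  by apply: nneseries_lim_ge => k _; rewrite lee_fin content_ge0.
rewrite sumEFin lee_fin big_mkord; apply: le_trans (content_bigsetU tbX Y F n).
rewrite (content_full tbX Y0)// => x /YD[k /= kD Fkx].
rewrite -bigcup_mkord; exists k => //=.
by rewrite ltnS; apply: leq_bigmax_seq.
Qed.

Lemma mu_ext_setT : mu setT <= 1.
Proof.
apply: (@le_trans _ _ (\sum_(k <oo) (tau (if k is 0%N then setT else set0))%:E)).
  by apply: mu_ext_le => [[|k]|x _]; [exact: openT|exact: open0|exists 0%N].
rewrite (nneseries_split _ 1)//; last by move=> *; rewrite lee_fin content_ge0.
rewrite eseries0 => [|[|i] _ _ //]; last by rewrite content0.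
by rewrite big_nat1 adde0 (content_full tbX Y0).
Qed.

Lemma mu_ext_preimage (g : X -> X) A :
    (forall x y, mdist (g x) (g y) = mdist x y) -> g @^-1` Y = Y ->
  mu (g @^-1` A) <= mu A.
Proof.
move=> gi gY; apply: mu_ext_ge => F oF AF.
apply: (@le_trans _ _ (\sum_(k <oo) (tau (g @^-1` F k))%:E)).
  apply: mu_ext_le => [k|x /AF[k _ Fk]]; last by exists k.
  apply/openP => x /((openP _).1 (oF k))[e e0 eF].
  by exists e => // y xy; apply: eF; rewrite gi.
apply: lee_nneseries => k _; rewrite lee_fin ?content_ge0//.
exact: content_preimage.
Qed.

(** The outer measure generated by the content is a metric outer measure, so it
    restricts to a Borel measure, and it inherits the isometry invariance of the
    covering numbers. *)
Lemma exists_invariant_probability : exists mu : probability (borel X) R,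
  mu Y = 1 /\ forall g h : X -> X,
    (forall x y, mdist (g x) (g y) = mdist x y) -> cancel g h -> cancel h g ->
    g @^-1` Y = Y -> forall A, mu (g @^-1` A) = mu A.
Proof.
have m0 : open_content set0 = 0 by rewrite open_contentE ?content0//; exact: open0.
pose om : {outer_measure set X -> \bar R} := HB.pack (mu : set X -> \bar R)
  (isOuterMeasure.Build R X (mu : set X -> \bar R) (mu_ext0 m0 open_content_ge0)
    (mu_ext_ge0 open_content_ge0) (@le_mu_ext _ _ _ open_content)
    (mu_ext_sigma_subadditive open_content_ge0)).
have muT_fin : om setT < +oo by apply: le_lt_trans mu_ext_setT _; exact: ltry.
have [c c_dense] := compact_dense_seq cX (fun n => @harmonic_gt0 R n).
have mball x r : om.-caratheodory (ball x r).
  rewrite (_ : ball x r = [set y | 0 < r - mdist x y]%R); last first.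
    by rewrite ballEmdist; apply/seteqP; split=> y /=; rewrite subr_gt0.
  apply: metric_outer_measure_caratheodory => //; first exact: mu_ext_metric.
  move=> y z; have := metric_triangle x y z; lra.
have mborel A : measurable (A : set (borel X)) -> om.-cara.-measurable A.
  apply: smallest_sub; first exact: sigma_algebra_measurable.
  move=> O oO; rewrite (open_bigcup_ball (@harmonic_lt R) c_dense oO).
  apply: bigcupT_measurable => n; apply: bigcupT_measurable => i.
  by case: asboolP => // _; exact: mball.
have m_sa : semi_sigma_additive (mu : set (borel X) -> \bar R).
  move=> F mF tF mUF; apply: (@caratheodory_measure_sigma_additive R X om F) => //.
    by move=> i; exact: mborel.
  exact: mborel.
have muT : mu [set: X] = 1.
  apply/eqP; rewrite eq_le mu_ext_setT /=; apply: le_trans mu_ext_compact _.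
  exact: le_mu_ext.
pose M : {measure set (borel X) -> \bar R} := HB.pack (mu : set (borel X) -> \bar R)
  (isMeasure.Build _ (borel X) R (mu : set (borel X) -> \bar R)
    (mu_ext0 m0 open_content_ge0) (mu_ext_ge0 open_content_ge0) m_sa).
pose P := HB.pack_for (probability (borel X) R) (Measure.sort M)
  (Measure_isProbability.Build _ (borel X) R M muT).
exists P; split.
  apply/eqP; rewrite eq_le mu_ext_compact andbT -muT; exact: le_mu_ext.
move=> g h gi gK hK gY A; apply/eqP; rewrite eq_le; apply/andP; split.
  exact: mu_ext_preimage.
have hgE (B : set X) : h @^-1` (g @^-1` B) = B.
  by apply/seteqP; split=> x /=; rewrite hK.
rewrite -[in leLHS](hgE A); apply: mu_ext_preimage.
  by move=> x y; rewrite -gi !hK.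
by rewrite -[in LHS]gY hgE.
Qed.

End measure_of_content.

(** * Unique ergodicity makes every orbit dense *)

Section action_lemmas.
Variables (R : realType) (G : topologicalGroupType) (X : pmetricType R).
Variable alpha : G -> X -> X.
Hypothesis alpha_act : is_action alpha.
Hypothesis alpha_isom : isometric alpha.

Lemma actK g : cancel (alpha g) (alpha (g^-1)%g).
Proof. by move=> x; rewrite -alpha_act.2 mulVg alpha_act.1. Qed.

Lemma actKV g : cancel (alpha (g^-1)%g) (alpha g).
Proof. by move=> x; rewrite -alpha_act.2 mulgV alpha_act.1. Qed.

Lemma isometric_open g (O : set X) : open O -> open (alpha g @^-1` O).
Proof.
move=> oO; apply/openP => x /((openP _).1 oO)[e e0 eO].
by exists e => // y xy; apply: eO; rewrite alpha_isom.
Qed.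

Definition orbit_closure (x : X) : set X :=
  [set y | forall e, 0 < e -> exists g, mdist (alpha g x) y < e].

Lemma orbit_closure_closed x : closed (orbit_closure x).
Proof.
rewrite -openC; apply/openP => y /existsNP[e /not_implyP[e0 /forallNP xy]].
exists (e / 2) => [|z yz xz]; first by rewrite divr_gt0.
have [|g gz] := xz (e / 2); first by rewrite divr_gt0.
apply: (xy g); have := metric_triangle (alpha g x) z y.
by rewrite (metric_sym z y); lra.
Qed.

Lemma orbit_closure_invariant x g : alpha g @^-1` orbit_closure x = orbit_closure x.
Proof.
apply/seteqP; split=> y /= xy e e0; have [h hy] := xy e e0.
  exists (g^-1 * h)%g; rewrite alpha_act.2.
  by rewrite -(alpha_isom g) actKV.
by exists (g * h)%g; rewrite alpha_act.2 alpha_isom.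
Qed.

Hypothesis cX : compact [set: X].

Lemma orbit_closure_probability x : exists mu : probability (borel X) R,
  mu (orbit_closure x) = 1%E /\ invariant_measure alpha mu.
Proof.
have [||mu [muY muI]] := @exists_invariant_probability R X cX (orbit_closure x).
- by apply: (subclosed_compact _ cX) => //; exact: orbit_closure_closed.
- by exists x => e e0; exists 1%g; rewrite alpha_act.1 mdistxx.
exists mu; split => // g A mA; rewrite /pushforward.
apply: (muI _ (alpha (g^-1)%g)); [exact: alpha_isom|exact: actK|exact: actKV|].
exact: orbit_closure_invariant.
Qed.

(** If [y] stays away from the orbit of [x], then the closures of the two orbits
    are disjoint; each carries an invariant probability measure, and these two
    measures cannot coincide. *)
Lemma uniquely_ergodic_dense : uniquely_ergodic alpha ->
  forall x y (e : R), 0 < e -> exists g, mdist (alpha g x) y < e.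
Proof.
move=> [mu [_ uniq]] x y e e0; apply: contrapT => /forallNP xy.
have [mx [mxx mxI]] := orbit_closure_probability x.
have [my [myy myI]] := orbit_closure_probability y.
have mO z : measurable (orbit_closure z : set (borel X)).
  rewrite -[X in measurable X]setCK; apply: measurableC; apply: sub_gen_smallest.
  by apply: closed_openC; exact: orbit_closure_closed.
have Ex : mu (orbit_closure x) = 1%E by rewrite -mxx; apply/esym/uniq.
have Ey : mu (orbit_closure y) = 1%E by rewrite -myy; apply/esym/uniq.
have muU : mu (orbit_closure x `|` orbit_closure y) = (1 + 1)%E.
  rewrite -[in X in (X + _)%E]Ex -Ey; apply: measureU => //.
  apply/seteqP; split => // z [xz yz].
  have e20 : 0 < e / 2 by rewrite divr_gt0.
  have [g gz] := xz _ e20; have [h hz] := yz _ e20.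
  apply: (xy (h^-1 * g)%g); rewrite alpha_act.2 -(alpha_isom h) actKV.
  have := metric_triangle (alpha g x) z (alpha h y).
  by rewrite (metric_sym z); lra.
have := @probability_le1 _ _ _ mu (orbit_closure x `|` orbit_closure y).
by rewrite muU -EFinD lee_fin => /(_ (measurableU _ _ (mO x) (mO y))); lra.
Qed.

End action_lemmas.

(** * Nearly invariant means on groups *)

Section group_means.
Variables (R : realType) (G : groupType).
Implicit Types (H gs : seq G) (Phi : G -> R).

(** The mean over [H] of left translates. These means commute with right
    translations, which is what couples them to almost periodicity. *)
Definition avg H Phi (k : G) : R := (\sum_(h <- H) Phi (h * k)%g) / (size H)%:R.

(** Total boundedness of the right translations of the group, as seen by [Phi] up
    to [eta]. It passes with the same net to all left means of [Phi]. *)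
Definition right_net gs (eta : R) Phi :=
  forall g, exists2 g', g' \in gs &
    forall h, `|Phi (h * g)%g - Phi (h * g')%g| <= eta.

Lemma sum_cst_seq (T : Type) (s : seq T) (c : R) : \sum_(i <- s) c = c * (size s)%:R.
Proof. by rewrite big_const_seq count_predT iter_addr_0 mulr_natr. Qed.

Lemma avg_le H Phi c k : H != [::] -> (forall h, h \in H -> Phi (h * k)%g <= c) ->
  avg H Phi k <= c.
Proof.
move=> H0 Hc; rewrite /avg ler_pdivrMr ?ltr0n ?lt0n ?size_eq0//.
rewrite -sum_cst_seq big_seq [leRHS]big_seq.
exact: ler_sum.
Qed.

Lemma avgB H Phi Psi k :
  avg H (fun g => Phi g - Psi g) k = avg H Phi k - avg H Psi k.
Proof. by rewrite /avg sumrB mulrBl. Qed.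

Lemma avgN H Phi k : avg H (fun g => - Phi g) k = - avg H Phi k.
Proof. by rewrite /avg sumrN mulNr. Qed.

Lemma avg_shift H Phi k l : avg H Phi (k * l)%g = avg H (fun g => Phi (g * l)%g) k.
Proof. by congr (_ / _); apply: eq_bigr => h _; rewrite mulgA. Qed.

Lemma avg_at1 H Phi k : avg H Phi k = avg H (fun g => Phi (g * k)%g) 1%g.
Proof. by rewrite -avg_shift mul1g. Qed.

Lemma avg_norm H Phi (c : R) k : H != [::] ->
  (forall g, `|Phi g| <= c) -> `|avg H Phi k| <= c.
Proof.
move=> H0 Phic; rewrite ler_norml; apply/andP; split; last first.
  by apply: avg_le => // h _; have := Phic (h * k)%g; rewrite ler_norml => /andP[].
rewrite lerNl -avgN; apply: avg_le => // h _.
by have := Phic (h * k)%g; rewrite ler_norml => /andP[+ _]; rewrite lerNl.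
Qed.

Lemma avg_avg H1 H2 Phi k :
  avg H2 (avg H1 Phi) k = avg [seq (h1 * h2)%g | h2 <- H2, h1 <- H1] Phi k.
Proof.
rewrite /avg size_allpairs natrM invfM big_allpairs_dep /= -mulr_suml -mulrA.
rewrite [_^-1 * _]mulrC; congr (_ * _); apply: eq_bigr => h2 _.
by apply: eq_bigr => h1 _; rewrite mulgA.
Qed.

Lemma right_net_avg gs eta Phi H : H != [::] ->
  right_net gs eta Phi -> right_net gs eta (avg H Phi).
Proof.
move=> H0 net g; have [g' g'gs gg'] := net g; exists g' => // h.
rewrite [avg _ _ (h * g)%g]avg_shift [avg _ _ (h * g')%g]avg_shift -avgB.
exact: avg_norm.
Qed.

Lemma avg_sum (J : finType) H (F : J -> G -> R) (l : G) :
  \sum_j avg H (F j) l = avg H (fun g => \sum_j F j g) l.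
Proof. by rewrite /avg -mulr_suml exchange_big. Qed.

Lemma avgZ H (c : R) (F : G -> R) l : avg H (fun g => c * F g) l = c * avg H F l.
Proof. by rewrite /avg -mulr_sumr mulrA. Qed.

Lemma avg_cst H (c : R) l : H != [::] -> avg H (fun _ : G => c) l = c.
Proof.
move=> H0; rewrite /avg sum_cst_seq mulfK// pnatr_eq0 size_eq0//.
Qed.

Definition nearly_constant (eta : R) Phi := forall k l, Phi k - Phi l <= eta.

(** Von Neumann's argument. Choose a mean whose supremum is within a small margin
    of the infimum of the suprema of all means. If that mean [psi] were much smaller at some
    [g0], then averaging [psi] over the translates by [g0 * g^-1], [g] in the
    net, would bring one term close to [psi g0] at every point, and so lower the
    supremum by a definite fraction: a contradiction. *)
Lemma exists_nearly_constant_avg Phi : (exists M, forall g, `|Phi g| <= M) ->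
    (forall eta, 0 < eta -> exists gs, right_net gs eta Phi) ->
  forall eta, 0 < eta -> exists2 H, H != [::] & nearly_constant eta (avg H Phi).
Proof.
move=> [M PhiM] net eta eta0.
have [|gs gs_net] := net (eta / 4); first by rewrite divr_gt0.
have gs0 : gs != [::] by case: (gs_net 1%g) => g'; case: (gs).
have m0 : 0 < (size gs)%:R :> R by rewrite ltr0n lt0n size_eq0.
set m : R := (size gs)%:R in m0.
pose E := [set c | exists2 H, H != [::] & forall k, avg H Phi k <= c].
have infE : has_inf E.
  split.
    exists M, [:: 1%g] => // k; apply: le_trans (ler_norm _) _; exact: avg_norm.
  exists (- M) => c [H H0 Hc]; apply: le_trans (Hc 1%g).
  by rewrite lerNl; apply: le_trans (ler_norm _) _; rewrite normrN; exact: avg_norm.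
(* the improvement obtained below is 3 * eta / (4 * m), larger than this margin *)
have em0 : 0 < eta / (4 * m) by rewrite divr_gt0// mulr_gt0.
have [c [H H0 Hc] cE] := inf_adherent em0 infE.
exists H => // k g0; rewrite leNgt; apply/negP => big.
set psi := avg H Phi in Hc big *.
pose hs := [seq (g0 * g^-1)%g | g <- gs].
have hs0 : hs != [::] by rewrite -size_eq0 size_map size_eq0.
have psi_net : right_net gs (eta / 4) psi by exact: right_net_avg.
suff : E (c - 3 * eta / (4 * m)).
  move=> /(ge_inf infE.2) le; have := lt_le_trans cE (lexx _).
  have : 3 * eta / (4 * m) = 3 * (eta / (4 * m)) by rewrite mulrA.
  move: le em0; clear; set z := eta / _; set w := 3 * eta / _; lra.
exists [seq (h1 * h2)%g | h2 <- hs, h1 <- H].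
  by rewrite -size_eq0 size_allpairs muln_eq0 !size_eq0 negb_or hs0.
move=> l; rewrite -avg_avg -/psi /avg size_map -/m ler_pdivrMr// mulrBl.
have [g' g'gs g'l] := psi_net l.
have le_g' : psi (g0 * g'^-1 * l)%g <= c - 3 * eta / 4.
  have := g'l (g0 * g'^-1)%g.
  rewrite -[(g0 * g'^-1 * g')%g]mulgA mulVg mulg1 ler_norml => /andP[_].
  by move: big (Hc k); clear; lra.
rewrite big_map (perm_big _ (perm_to_rem g'gs)) big_cons/=.
have -> : c * m - 3 * eta / (4 * m) * m = c - 3 * eta / 4 + c * (m - 1).
  by field; rewrite gt_eqF.
apply: lerD => //.
have -> : m - 1 = (size (rem g' gs))%:R.
  by rewrite size_rem// -subn1 natrB// lt0n size_eq0.
rewrite -sum_cst_seq.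
by apply: ler_sum => g _; exact: Hc.
Qed.

(** Means compose, and averaging preserves near constancy: the functions can be
    treated one after the other. *)
Lemma exists_nearly_constant_avgs (I : eqType) (s : seq I) (Phi : I -> G -> R) :
    (forall i, exists M, forall g, `|Phi i g| <= M) ->
    (forall i eta, 0 < eta -> exists gs, right_net gs eta (Phi i)) ->
  forall eta, 0 < eta -> exists2 H, H != [::] &
    forall i, i \in s -> nearly_constant eta (avg H (Phi i)).
Proof.
move=> PhiM net eta eta0; elim: s => [|i s [H H0 Hs]]; first by exists [:: 1%g].
have [||H' H'0 H's] := @exists_nearly_constant_avg (avg H (Phi i)) _ _ eta eta0.
- by have [M iM] := PhiM i; exists M => g; exact: avg_norm.
- move=> e e0; have [gs gsP] := net i e e0; exists gs; exact: right_net_avg.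
exists [seq (h1 * h2)%g | h2 <- H', h1 <- H].
  by rewrite -size_eq0 size_allpairs muln_eq0 !size_eq0 negb_or H'0.
move=> j; rewrite inE => /predU1P[->|js] k l; rewrite -!avg_avg; first exact: H's.
rewrite [in X in X - _]avg_at1 [in X in _ - X]avg_at1 -avgB.
by apply: avg_le => // h _; exact: Hs.
Qed.

End group_means.

(** * A coupling of finitely many masses *)

(** [mu] and [nu] are the masses that two invariant measures give to the members of
    a partition of unity. Entry [A a i g] is the mass of [mu] which lies at [a] and
    is carried to [i] by [g]; [B] is the same for [nu]. *)
Section averaged_coupling.
Variables (R : realType) (G : groupType) (I : finType).
Variables (mu nu : I -> R) (A B : I -> I -> G -> R) (k : I -> I -> G).
Variable rel : I -> I -> Prop.
Hypotheses (A_ge0 : forall a i g, 0 <= A a i g)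
  (B_ge0 : forall b j g, 0 <= B b j g).
Hypotheses (A_row : forall a g, \sum_i A a i g = mu a)
  (A_col : forall i g, \sum_a A a i g = mu i).
Hypotheses (B_row : forall b g, \sum_j B b j g = nu b)
  (B_col : forall j g, \sum_b B b j g = nu j).
Hypotheses (mu1 : \sum_a mu a = 1) (nu1 : \sum_b nu b = 1).
Hypothesis B_net : forall b j eta, 0 < eta -> exists gs, right_net gs eta (B b j).
Hypothesis AB_rel : forall a b i j h,
  A a i h != 0 -> B b j (h * k a b)%g != 0 -> rel i j.

Let mu_ge0 a : 0 <= mu a.
Proof. by rewrite -(A_row a 1%g); exact: sumr_ge0. Qed.

(** A pair of points lying at [a] and [b], drawn independently, is moved by [h] and
    [h * k a b] respectively, where [k a b] brings [b] next to [a]; the plan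
    records where it lands. The first marginal is exactly [mu], while the second
    one involves the translates by [k a b], whose effect disappears in the mean
    over [h]. *)
Let plan h i j := \sum_a \sum_b A a i h * B b j (h * k a b)%g.

Let plan_ge0 h i j : 0 <= plan h i j.
Proof. by apply: sumr_ge0 => a _; apply: sumr_ge0 => b _; rewrite mulr_ge0. Qed.

Let plan_row h i : \sum_j plan h i j = mu i.
Proof.
rewrite exchange_big /= -(A_col i h); apply: eq_bigr => a _.
rewrite exchange_big /= -[RHS]mulr1 -nu1 mulr_sumr; apply: eq_bigr => b _.
by rewrite -mulr_sumr B_row.
Qed.

Let plan_col h j : \sum_i plan h i j = \sum_a \sum_b mu a * B b j (h * k a b)%g.
Proof.
rewrite exchange_big; apply: eq_bigr => a _.
rewrite exchange_big; apply: eq_bigr => b _.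
by rewrite -mulr_suml A_row.
Qed.

Let approx n : exists2 H, H != [::] & forall b j,
  nearly_constant (harmonic n) (avg H (B b j)).
Proof.
have [|||H H0 HB] := @exists_nearly_constant_avgs R G (I * I)%type
    (enum {: I * I}) (fun bj => B bj.1 bj.2) _ _ (harmonic n).
- move=> [b j]; exists (nu b) => g /=; rewrite ger0_norm// -(B_row b g).
  by rewrite (bigD1 j)//= lerDl sumr_ge0.
- by move=> [b j]; exact: B_net.
- exact: harmonic_gt0.
by exists H => // b j; apply: (HB (b, j)); rewrite mem_enum.
Qed.

Let H_ n := s2val (cid2 (approx n)).

Let H_neq0 n : H_ n != [::]. Proof. by rewrite /H_; case: cid2. Qed.

Let H_P n b j : nearly_constant (harmonic n) (avg (H_ n) (B b j)).
Proof. by rewrite /H_; case: cid2. Qed.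

Let w n i j := avg (H_ n) (fun h => plan h i j) 1%g.

Let w_ge0 n i j : 0 <= w n i j.
Proof. by rewrite /w /avg divr_ge0// sumr_ge0. Qed.

Let w_row n i : \sum_j w n i j = mu i.
Proof.
rewrite avg_sum -[RHS](avg_cst _ 1%g (H_neq0 n)); congr avg.
by apply/funext => h; exact: plan_row.
Qed.

Let w_col n j : `|nu j - \sum_i w n i j| <= #|I|%:R * harmonic n.
Proof.
rewrite avg_sum; under [X in avg _ X]funext do rewrite plan_col.
rewrite -avg_sum.
have -> : nu j = \sum_a \sum_b mu a * avg (H_ n) (B b j) 1%g.
  under eq_bigr do rewrite -mulr_sumr.
  rewrite -mulr_suml mu1 mul1r avg_sum -[LHS](avg_cst _ 1%g (H_neq0 n)).
  by congr avg; apply/funext => h; rewrite B_col.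
rewrite -sumrB; apply: le_trans (ler_norm_sum _ _ _) _.
apply: (@le_trans _ _ (\sum_a mu a * (#|I|%:R * harmonic n))); last first.
  by rewrite -mulr_suml mu1 mul1r.
apply: ler_sum => a _; rewrite -avg_sum -sumrB.
apply: le_trans (ler_norm_sum _ _ _) _.
rewrite mulrA -mulrAC mulr_natr -sumr_const; apply: ler_sum => b _.
rewrite avgZ -avg_at1 -mulrBr normrM (ger0_norm (mu_ge0 a)).
apply: ler_wpM2l => //; rewrite ler_norml lerNl opprB.
by rewrite !H_P.
Qed.

(** The means of the plans have a second marginal tending to [nu]; an ultralimit of
    them is an exact coupling, still supported on [rel]. *)
Lemma averaged_coupling : exists w : I -> I -> R,
  [/\ forall i j, 0 <= w i j, forall i, \sum_j w i j = mu i,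
      forall j, \sum_i w i j = nu j & forall i j, w i j != 0 -> rel i j].
Proof.
have w_bnd i j : exists M, forall n, `|w n i j| <= M.
  exists (mu i) => n; rewrite ger0_norm// -(w_row n i).
  by rewrite [leRHS](bigD1 j)//= lerDl sumr_ge0.
exists (fun i j => ulim (fun n => w n i j)); split.
- move=> i j; rewrite -[0](ulim_cst 0); apply: le_ulim => //.
    by exists 0 => _; rewrite normr0.
  by apply: nearW => n; exact: w_ge0.
- move=> i; rewrite -(ulim_sum (u := fun j n => w n i j))// -[RHS]ulim_cst.
  by congr ulim; apply/funext => n; exact: w_row.
- move=> j; rewrite -(ulim_sum (u := fun i n => w n i j))//.
  apply: cvg_ulim; apply/cvgrPdist_le => e e0.
  have d0 : 0 < e / (#|I|%:R + 1) by rewrite divr_gt0.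
  near=> n; apply: le_trans (w_col n j) _.
  have : harmonic n < e / (#|I|%:R + 1).
    by near: n; exact: (near_infty_natSinv_lt (PosNum d0)).
  rewrite ltr_pdivlMr// => /ltW; apply: le_trans.
  by rewrite mulrC ler_wpM2l ?lerDl// harmonic_ge0.
- move=> i j; apply: contra_neqP => ij.
  rewrite -[RHS]ulim_cst; congr ulim; apply/funext => n.
  rewrite /w /avg big1 ?mul0r// => h _; rewrite /plan big1// => a _.
  rewrite big1// => b _; apply/eqP; rewrite mulf_eq0; apply/negPn/negP.
  by rewrite negb_or mulg1 => /andP[Aa Bb]; apply: ij; exact: AB_rel Aa Bb.
Unshelve. all: by end_near. Qed.

End averaged_coupling.

(** * Borel sets of a product and integrals of tensors *)

Section borel_measurability.
Variable R : realType.

Lemma measurable_superlevel (T : pointedType) (O : set (set T)) (f : T -> R) :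
  (forall t, O [set x | t < f x]) ->
  measurable_fun setT (f : g_sigma_algebraType O -> R).
Proof.
move=> Of; apply: (measurability _ (RGenOInfty.measurableE R)).
move=> _ [_ [t ->] <-]; rewrite setTI; apply: sub_gen_smallest.
rewrite (_ : f @^-1` _ = [set x | t < f x]); first exact: Of.
by apply/seteqP; split=> x /=; rewrite in_itv /= andbT.
Qed.

Lemma lipschitz_measurable (X : pmetricType R) (f : X -> R) (L : R) :
  (forall x y, `|f x - f y| <= L * mdist x y) ->
  measurable_fun setT (f : borel X -> R).
Proof.
move=> fL; apply: measurable_superlevel => t; apply/openP => x /= tx.
have L0 : 0 < `|L| + 1 by rewrite ltr_wpDl.
exists ((f x - t) / (`|L| + 1)) => [|y]; first by rewrite divr_gt0// subr_gt0.
rewrite ltr_pdivlMr// => xy.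
have : L * mdist x y <= mdist x y * (`|L| + 1).
  rewrite mulrC; apply: ler_wpM2l; first exact: mdist_ge0.
  by apply: le_trans (ler_norm _) _; rewrite lerDl.
by have := fL x y; rewrite ler_norml => /andP[_]; lra.
Qed.

Lemma mdist_measurable (X : pmetricType R) :
  measurable_fun setT ((fun z => mdist z.1 z.2) : borel (X * X)%type -> R).
Proof.
apply: measurable_superlevel => t.
rewrite openE => -[x y] /= txy; apply/nbhs_ballP.
exists ((mdist x y - t) / 2) => /=; first by rewrite divr_gt0// subr_gt0.
move=> -[x' y'] []; rewrite /= !ballEmdist /= => xx' yy'.
have := metric_triangle x x' y; have := metric_triangle x' y' y.
rewrite (metric_sym y'); lra.
Qed.

(** Compact metric spaces are second countable, hence an open set of the square is
    a countable union of open rectangles. *)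
Lemma borelX_measurable (X : pmetricType R) (B : set (X * X)) :
  compact [set: X] -> measurable (B : set (borel (X * X)%type)) ->
  measurable (B : set (borel X * borel X)%type).
Proof.
move=> cX; apply: smallest_sub; first exact: sigma_algebra_measurable.
have [c c_dense] := compact_dense_seq cX (fun n => @harmonic_gt0 R n).
move=> O oO; rewrite (openX_bigcup_ball (@harmonic_lt R) c_dense oO).
apply: bigcupT_measurable => n; apply: bigcupT_measurable => i.
apply: bigcupT_measurable => j; case: asboolP => // _.
by apply: measurableX; apply: sub_gen_smallest; exact: mdist_ball_open.
Qed.

End borel_measurability.

Section tensor.
Local Open Scope ereal_scope.
Context d1 d2 (T1 : measurableType d1) (T2 : measurableType d2) (R : realType).
Variables (mu : probability T1 R) (nu : probability T2 R).

Lemma integral_tensor (f : T1 -> R) (g : T2 -> R) (A : set T1) (B : set T2) :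
    measurable A -> measurable B ->
    measurable_fun setT f -> measurable_fun setT g ->
    (forall x, 0 <= f x)%R -> (forall y, 0 <= g y)%R ->
  \int[mu \x nu]_(z in A `*` B) (f z.1 * g z.2)%:E =
  \int[mu]_(x in A) (f x)%:E * \int[nu]_(y in B) (g y)%:E.
Proof.
move=> mA mB mf mg f0 g0.
rewrite integral_mkcond [X in _ = X * _]integral_mkcond [X in _ = _ * X]integral_mkcond.
rewrite !restrict_EFin.
have mfA : measurable_fun setT (f \_ A).
  by apply/(measurable_restrictT _ _).1 => //; exact: measurable_funTS.
have mgB : measurable_fun setT (g \_ B).
  by apply/(measurable_restrictT _ _).1 => //; exact: measurable_funTS.
have fA0 x : (0 <= (f \_ A) x)%R by rewrite patchE; case: ifP.
have gB0 x : (0 <= (g \_ B) x)%R by rewrite patchE; case: ifP.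
have -> : ((fun z : T1 * T2 => f z.1 * g z.2)%R \_ (A `*` B)) =
    (fun z => (f \_ A) z.1 * (g \_ B) z.2)%R.
  apply/funext => -[x y]; rewrite !patchE /= in_setX.
  by case: (x \in A); case: (y \in B); rewrite ?mulr0 ?mul0r.
rewrite fubini_tonelli1; last 2 first.
- apply/measurable_EFinP; apply: measurable_funM; apply: measurableT_comp => //.
- by move=> z; rewrite lee_fin mulr_ge0.
rewrite /fubini_F /=.
under eq_integral => x _.
  under eq_integral do rewrite EFinM.
  rewrite ge0_integralZl_EFin//; last 2 first.
  - by move=> y _; rewrite lee_fin.
  - exact/measurable_EFinP.
  over.
rewrite ge0_integralZr//.
- exact/measurable_EFinP.
- by move=> x _; rewrite lee_fin.
- by apply: integral_ge0 => y _; rewrite lee_fin.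
Qed.

End tensor.

(** * From finite couplings to couplings of measures *)

(** A coupling [w] of the masses [mass mu setT] and [mass nu setT] of a partition of
    unity lifts to a coupling of [mu] and [nu]: spread the weight [w i j] according
    to the product of the normalised measures of densities [chi i] and [chi j]. *)
Section weighted_coupling.
Variables (R : realType) (X : pmetricType R) (I : finType).
Hypothesis cX : compact [set: X].
Variables (mu nu : probability (borel X) R) (chi : I -> X -> R).
Hypotheses (chi_ge0 : forall i x, 0 <= chi i x)
  (chi_sum : forall x, \sum_i chi i x = 1).
Hypothesis chi_meas : forall i, measurable_fun setT (chi i : borel X -> R).

Lemma chi_le1 i x : chi i x <= 1.
Proof. by rewrite -(chi_sum x) (bigD1 i)//= lerDl sumr_ge0. Qed.

Definition mass (m : probability (borel X) R) (A : set (borel X)) i : R :=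
  fine (\int[m]_(x in A) (chi i x)%:E).

Section mass.
Variable m : probability (borel X) R.

Lemma massE A i : measurable A ->
  (\int[m]_(x in A) (chi i x)%:E)%E = (mass m A i)%:E.
Proof.
move=> mA; rewrite /mass fineK// ge0_fin_numE; last first.
  by apply: integral_ge0 => x _; rewrite lee_fin.
apply: (@le_lt_trans _ _ (\int[m]_(x in A) (cst 1%E x)))%E.
  apply: ge0_le_integral => //.
  - by move=> x _; rewrite lee_fin.
  - by apply/measurable_EFinP; exact: measurable_funTS.
  - by move=> x _; rewrite lee_fin chi_le1.
rewrite integral_cst// mul1e; apply: le_lt_trans (probability_le1 m mA) _.
exact: ltry.
Qed.

Lemma mass_ge0 A i : 0 <= mass m A i.
Proof. by apply: fine_ge0; apply: integral_ge0 => x _; rewrite lee_fin. Qed.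

Lemma mass_le A i : measurable A -> mass m A i <= mass m setT i.
Proof.
move=> mA; rewrite -lee_fin -!massE//; apply: ge0_subset_integral => //.
  exact/measurable_EFinP.
by move=> x _; rewrite lee_fin.
Qed.

Lemma mass_sum A : measurable A -> (\sum_i mass m A i)%:E = m A.
Proof.
move=> mA; rewrite -sumEFin; under eq_bigr do rewrite -massE//.
rewrite -ge0_integral_sum//.
- rewrite (eq_integral (cst 1%E)); last first.
    by move=> x _; rewrite sumEFin chi_sum.
  by rewrite integral_cst// mul1e.
- by move=> i; apply/measurable_EFinP; exact: measurable_funTS.
- by move=> i x _; rewrite lee_fin.
Qed.

End mass.

Variable w : I -> I -> R.
Hypotheses (w_ge0 : forall i j, 0 <= w i j)
  (w_row : forall i, \sum_j w i j = mass mu setT i)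
  (w_col : forall j, \sum_i w i j = mass nu setT j).

Let P := (mu \x nu)%E.

Let coef i j := w i j / (mass mu setT i * mass nu setT j).

Let rho (z : X * X) : R := \sum_i \sum_j coef i j * (chi i z.1 * chi j z.2).

Let coef_ge0 i j : 0 <= coef i j.
Proof. by rewrite divr_ge0// mulr_ge0// mass_ge0. Qed.

Let rho_ge0 z : 0 <= rho z.
Proof.
apply: sumr_ge0 => i _; apply: sumr_ge0 => j _.
by apply: mulr_ge0 => //; exact: mulr_ge0.
Qed.

Let chi2_meas i j :
  measurable_fun setT (fun z : borel X * borel X => chi i z.1 * chi j z.2).
Proof.
apply: measurable_funM.
  exact: (measurableT_comp (chi_meas i) measurable_fst).
exact: (measurableT_comp (chi_meas j) measurable_snd).
Qed.

Let rho_meas : measurable_fun setT (rho : borel X * borel X -> R).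
Proof.
apply: measurable_sum => i; apply: measurable_sum => j.
by apply: measurable_funM => //; exact: chi2_meas.
Qed.

Let pi_ (B : set (borel (X * X)%type)) : \bar R := (\int[P]_(z in B) (rho z)%:E)%E.

Let pi_E (A B : set (borel X)) : measurable A -> measurable B ->
  pi_ (A `*` B) = (\sum_i \sum_j coef i j * (mass mu A i * mass nu B j))%:E.
Proof.
move=> mA mB; have mAB : measurable (A `*` B) by exact: measurableX.
rewrite /pi_ /rho; under eq_integral do rewrite -sumEFin.
rewrite ge0_integral_sum//; last 2 first.
- move=> i; apply/measurable_EFinP; apply: measurable_funTS.
  by apply: measurable_sum => j; apply: measurable_funM => //; exact: chi2_meas.
- move=> i z _; rewrite lee_fin; apply: sumr_ge0 => j _.
  by apply: mulr_ge0 => //; exact: mulr_ge0.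
rewrite -sumEFin; apply: eq_bigr => i _.
under eq_integral do rewrite -sumEFin.
rewrite ge0_integral_sum//; last 2 first.
- move=> j; apply/measurable_EFinP; apply: measurable_funTS.
  by apply: measurable_funM => //; exact: chi2_meas.
- by move=> j z _; rewrite lee_fin; apply: mulr_ge0 => //; exact: mulr_ge0.
rewrite -sumEFin; apply: eq_bigr => j _.
under eq_integral do rewrite EFinM.
rewrite ge0_integralZl_EFin//; last 2 first.
- by move=> z _; rewrite lee_fin mulr_ge0.
- by apply/measurable_EFinP; apply: measurable_funTS; exact: chi2_meas.
by rewrite EFinM integral_tensor// !massE.
Qed.

(** Marginals of the density. An index of zero mass is harmless: division by 0
    gives 0, and both [w] and [c] vanish there. *)
Let weighted_sum (u : I -> I -> R) (a b c : I -> R) :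
    (forall i j, 0 <= u i j) -> (forall i, \sum_j u i j = a i) ->
    (forall j, \sum_i u i j = b j) -> (forall i, 0 <= c i <= a i) ->
  \sum_i \sum_j u i j / (a i * b j) * (c i * b j) = \sum_i c i.
Proof.
move=> u0 ua ub ca; apply: eq_bigr => i _.
transitivity (\sum_j u i j * (c i / a i)).
  apply: eq_bigr => j _; have [bj0|bj0] := eqVneq (b j) 0.
    suff -> : u i j = 0 by rewrite !mul0r.
    have /eqP := ub j; rewrite bj0 psumr_eq0//.
    by move=> /allP/(_ i (mem_index_enum _))/eqP.
  by rewrite invfM -[RHS]mulr1 -(mulVf bj0); ring.
rewrite -mulr_suml ua; have [ai0|ai0] := eqVneq (a i) 0; last by field.
by have := ca i; rewrite ai0 mul0r -eq_le => /eqP.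
Qed.

Let pi_fst (A : set (borel X)) : measurable A -> pi_ (fst @^-1` A) = mu A.
Proof.
move=> mA; rewrite (_ : fst @^-1` A = A `*` setT); last by rewrite setXT.
rewrite pi_E// -(mass_sum mu mA); congr EFin.
by apply: weighted_sum => // i; rewrite mass_ge0 mass_le.
Qed.

Let pi_snd (A : set (borel X)) : measurable A -> pi_ (snd @^-1` A) = nu A.
Proof.
move=> mA; rewrite (_ : snd @^-1` A = setT `*` A); last by rewrite setTX.
rewrite pi_E// -(mass_sum nu mA); congr EFin; rewrite exchange_big /=.
rewrite -[RHS](@weighted_sum (fun j i => w i j) (mass nu setT) (mass mu setT)
  (mass nu A))//.
  apply: eq_bigr => j _; apply: eq_bigr => i _.
  by rewrite /coef [mass mu setT i * _]mulrC [mass mu setT i * _]mulrC.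
by move=> i; rewrite mass_ge0 mass_le.
Qed.

(** The density vanishes at the pairs farther apart than [D]. *)
Lemma exists_weighted_coupling (D : R) :
    (forall i j x y, w i j != 0 -> chi i x != 0 -> chi j y != 0 ->
      mdist x y <= D) ->
  exists pi : probability (borel (X * X)%type) R,
    coupling mu nu pi /\ pi [set z | D < mdist z.1 z.2] = 0%E.
Proof.
move=> supp.
have pi0 : pi_ set0 = 0%E by exact: integral_set0.
have pi_ge0 B : (0 <= pi_ B)%E by apply: integral_ge0 => z _; rewrite lee_fin.
have pi_sa : semi_sigma_additive pi_.
  move=> F mF tF mUF.
  have mrho := (measurable_EFinP _ _).2 rho_meas.
  have rho0 z : (0 <= (EFin \o rho) z)%E by rewrite lee_fin.
  apply: (semi_sigma_additive_nng_induced mrho rho0) => //.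
    by move=> i; exact: borelX_measurable.
  exact: borelX_measurable.
have pi1 : pi_ setT = 1%E by rewrite -(preimage_setT fst) pi_fst// probability_setT.
pose M : {measure set (borel (X * X)%type) -> \bar R} := HB.pack pi_
  (isMeasure.Build _ (borel (X * X)%type) R pi_ pi0 pi_ge0 pi_sa).
pose Q := HB.pack_for (probability (borel (X * X)%type) R) (Measure.sort M)
  (Measure_isProbability.Build _ (borel (X * X)%type) R M pi1).
exists Q; split; first by move=> A mA; split; [exact: pi_fst|exact: pi_snd].
apply: integral0_eq => -[x y] /= Dxy; congr EFin.
apply: big1 => i _; apply: big1 => j _; apply/eqP; rewrite !mulf_eq0 invr_eq0.
apply/negPn/negP; rewrite !negb_or => /andP[/andP[wij _] /andP[ix jy]].
by have := supp i j x y wij ix jy; rewrite leNgt Dxy.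
Qed.

End weighted_coupling.

Section wasserstein_bound.
Variables (R : realType) (X : pmetricType R).

(** A coupling concentrated on pairs at distance at most [D] costs at most
    [D `^ p], whatever [p] is. *)
Lemma wasserstein_le (mu nu : probability (borel X) R) pi (p D : R) :
    1 <= p -> 0 <= D -> coupling mu nu pi ->
    pi [set z | D < mdist z.1 z.2] = 0%E ->
  (wasserstein p mu nu <= D%:E)%E.
Proof.
move=> p1 D0 muncpl piD; have p0 : 0 < p by apply: lt_le_trans p1.
pose N : set (borel (X * X)%type) := [set z | D < mdist z.1 z.2].
have mN : measurable N.
  rewrite -[X in measurable X]setTI.
  have := @mdist_measurable R X measurableT `]D, +oo[%classic.
  rewrite (_ : _ @^-1` `]D, +oo[ = N); first by apply; exact: measurable_itv.
  by apply/seteqP; split=> z /=; rewrite in_itv /= andbT.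
pose f (z : borel (X * X)%type) := ((mdist z.1 z.2) `^ p)%:E.
have f0 z : (0 <= f z)%E by rewrite lee_fin powR_ge0.
have mf : measurable_fun setT f.
  apply/measurable_EFinP.
  exact: (measurableT_comp (measurable_powR p) (@mdist_measurable R X)).
have cost : (\int[pi]_z f z <= (D `^ p)%:E)%E.
  rewrite (ge0_negligible_integral mN)//.
  have mTN : measurable (setT `\` N) by exact: measurableD.
  apply: (@le_trans _ _ (\int[pi]_(z in setT `\` N) cst (D `^ p)%:E z)%E).
    apply: ge0_le_integral => //.
    - exact: measurable_funTS.
    - move=> z [_ /= /negP]; rewrite -leNgt => zD; rewrite lee_fin.
      by apply: ge0_ler_powR; rewrite ?nnegrE ?mdist_ge0// ltW.
  rewrite integral_cst// -[leRHS]mule1; apply: lee_wpmul2l.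
    by rewrite lee_fin powR_ge0.
  exact: probability_le1.
rewrite /wasserstein; set W := ereal_inf _.
have WD : (W <= (D `^ p)%:E)%E.
  by apply: le_trans cost; apply: ereal_inf_lbound; exists pi.
have W0 : (0 <= W)%E.
  apply: le_ereal_inf_tmp => _ [q _ <-]; apply: integral_ge0 => z _.
  by rewrite lee_fin powR_ge0.
apply: (@le_trans _ _ ((D `^ p)%:E `^ p^-1)%E).
  apply: gt0_ler_poweR => //; first by rewrite invr_ge0 ltW.
    by rewrite in_itv /= W0 leey.
  by rewrite in_itv /= leey lee_fin powR_ge0.
by rewrite poweR_EFin -powRrM mulfV ?gt_eqF// powRr1.
Qed.

End wasserstein_bound.

(** * Partitions of unity and invariant integrals *)

Section lipschitz_partition.
Variables (R : realType) (X : pmetricType R).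
Hypothesis cX : compact [set: X].

(** Tents of radius [s] about an [s / 2]-net, divided by their sum, which is at
    least [s / 2]; an explicit Lipschitz constant follows. *)
Lemma lipschitz_partition (s : R) : 0 < s ->
  exists m (c : 'I_m -> X) (chi : 'I_m -> X -> R) (L : R), 0 <= L /\
  [/\ forall i x, 0 <= chi i x, forall x, \sum_i chi i x = 1,
      forall i x, chi i x != 0 -> mdist (c i) x < s &
      forall i x y, `|chi i x - chi i y| <= L * mdist x y].
Proof.
move=> s0; have s20 : 0 < s / 2 by rewrite divr_gt0.
have [l lX] := compact_net cX s20.
pose c (i : 'I_(size l)) := nth point l i.
pose th i x := Num.max 0 (s - mdist (c i) x).
pose S x := \sum_i th i x.
have th_ge0 i x : 0 <= th i x by rewrite /th le_max lexx.
have th_lip i x y : `|th i x - th i y| <= mdist x y.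
  have := mdist_quadrangle (c i) (c i) x y.
  rewrite mdistxx add0r ler_norml => /andP[h1 h2].
  rewrite /th ler_norml; apply/andP; split.
    by case: (lerP 0 (s - mdist (c i) x)); case: (lerP 0 (s - mdist (c i) y)); lra.
  by case: (lerP 0 (s - mdist (c i) x)); case: (lerP 0 (s - mdist (c i) y)); lra.
have S_ge x : s / 2 <= S x.
  have [y yl yx] := lX x; have il : (index y l < size l)%N by rewrite index_mem.
  rewrite /S (bigD1 (Ordinal il))//= -[leLHS]addr0.
  apply: lerD; last exact: sumr_ge0.
  by rewrite /th /c /= nth_index// le_max; apply/orP; right; lra.
have S_gt0 x : 0 < S x by apply: lt_le_trans (S_ge x).
have th_le i x : th i x <= S x by rewrite /S (bigD1 i)//= lerDl sumr_ge0.
have S_lip x y : `|S x - S y| <= (size l)%:R * mdist x y.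
  rewrite /S -sumrB; apply: le_trans (ler_norm_sum _ _ _) _.
  rewrite mulr_natl -[X in _ *+ X]card_ord -sumr_const.
  by apply: ler_sum => i _; exact: th_lip.
exists (size l), c, (fun i x => th i x / S x), ((1 + (size l)%:R) / (s / 2)).
split; first by rewrite divr_ge0// ?addr_ge0// ltW.
split => [i x|x|i x|i x y].
- by rewrite divr_ge0// ltW.
- by rewrite -mulr_suml -/(S x) divff// gt_eqF// S_gt0.
- apply: contra_neqT; rewrite -leNgt => sx; rewrite /th max_l ?mul0r//; lra.
have -> : th i x / S x - th i y / S y =
    ((th i x - th i y) + (th i y / S y) * (S y - S x)) / S x.
  by field; rewrite !gt_eqF.
rewrite normrM [in leLHS]normfV (gtr0_norm (S_gt0 x)).
rewrite [leRHS]mulrAC; apply: ler_pM => //; first by rewrite invr_ge0 ltW.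
  rewrite [leRHS]mulrDl mul1r.
  apply: le_trans (ler_normD _ _) (lerD (th_lip i x y) _).
  rewrite normrM metric_sym -[leRHS]mul1r; apply: ler_pM => //.
  rewrite ger0_norm ?divr_ge0 ?(ltW (S_gt0 y))//.
  by rewrite ler_pdivrMr// mul1r.
by rewrite lef_pV2 ?posrE.
Qed.

End lipschitz_partition.

Section bounded_measurable.
Variables (R : realType) (X : pmetricType R).
Implicit Types (f g : X -> R) (m : probability (borel X) R).

Definition bounded_measurable f :=
  measurable_fun setT (f : borel X -> R) /\ exists M, forall x, `|f x| <= M.

Lemma bounded_measurable_integrable m f : bounded_measurable f ->
  m.-integrable setT (EFin \o f : borel X -> \bar R).
Proof.
move=> [mf [M fM]]; apply: measurable_bounded_integrable => //.
  by rewrite -ge0_fin_numE// fin_num_measure.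
by exists M; split; [exact: num_real|move=> N MN x _; exact: le_trans (ltW MN)].
Qed.

Lemma bounded_measurableM f g : bounded_measurable f -> bounded_measurable g ->
  bounded_measurable (fun x => f x * g x).
Proof.
move=> [mf [M fM]] [mg [N gN]]; split; first exact: measurable_funM.
by exists (M * N) => x; rewrite normrM ler_pM.
Qed.

Lemma bounded_measurableB f g : bounded_measurable f -> bounded_measurable g ->
  bounded_measurable (fun x => f x - g x).
Proof.
move=> [mf [M fM]] [mg [N gN]]; split; first exact: measurable_funB.
by exists (M + N) => x; apply: le_trans (ler_normB _ _) _; exact: lerD.
Qed.

Lemma bounded_measurable_sum (I : Type) (s : seq I) (f : I -> X -> R) :
  (forall i, bounded_measurable (f i)) ->
  bounded_measurable (fun x => \sum_(i <- s) f i x).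
Proof.
move=> bf; split; first by apply: measurable_sum => i; have [] := bf i.
elim: s => [|i s [M IHs]]; first by exists 0 => x; rewrite big_nil normr0.
have [_ [N fN]] := bf i; exists (N + M) => x; rewrite big_cons.
by apply: le_trans (ler_normD _ _) _; exact: lerD.
Qed.

Lemma Rintegral_sum m (I : Type) (s : seq I) (f : I -> X -> R) :
  (forall i, bounded_measurable (f i)) ->
  \int[m]_x (\sum_(i <- s) f i x) = \sum_(i <- s) \int[m]_x f i x.
Proof.
move=> bf; elim: s => [|i s IHs].
  under eq_Rintegral do rewrite big_nil.
  by rewrite big_nil Rintegral_cst// mul0r.
under eq_Rintegral do rewrite big_cons.
rewrite big_cons RintegralD// ?IHs//; apply: bounded_measurable_integrable => //.
exact: bounded_measurable_sum.
Qed.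

Lemma le_norm_Rintegral m f (c : R) : bounded_measurable f ->
  (forall x, `|f x| <= c) -> `|\int[m]_x f x| <= c.
Proof.
move=> bf fc; have [mf _] := bf.
have intf := bounded_measurable_integrable m bf.
apply: le_trans (le_normr_Rintegral measurableT intf) _.
apply: (@le_trans _ _ (\int[m]_x cst c x)).
  apply: le_Rintegral => //; apply: bounded_measurable_integrable.
    split; first exact: measurableT_comp.
    by exists c => x; rewrite normr_id.
  by split; [exact: measurable_cst|exists `|c|].
by rewrite Rintegral_cst// [X in fine X](probability_setT m) mulr1.
Qed.

Lemma Rintegral_neq0 m f : \int[m]_x f x != 0 -> exists x, f x != 0.
Proof.
apply: contra_neqP => /forallNP f0.
rewrite (@eq_Rintegral _ _ _ m setT (cst 0) f) ?Rintegral_cst ?mul0r// => x _ /=.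
by apply/eqP/negPn/negP; exact: f0.
Qed.

End bounded_measurable.

Section invariant_integral.
Variables (R : realType) (G : topologicalGroupType) (X : pmetricType R).
Variable alpha : G -> X -> X.
Hypothesis alpha_isom : isometric alpha.

Lemma act_measurable g : measurable_fun setT (alpha g : borel X -> borel X).
Proof.
apply: (@measurability _ _ (borel X) (borel X) setT (alpha g) (@open X)) => //.
move=> _ [U oU <-]; rewrite setTI; apply: sub_gen_smallest.
exact: isometric_open.
Qed.

Lemma bounded_measurable_act g (f : X -> R) :
  bounded_measurable f -> bounded_measurable (fun x => f (alpha g x)).
Proof.
move=> [mf [M fM]]; split; last by exists M.
exact: (measurableT_comp mf (act_measurable g)).
Qed.

Lemma Rintegral_invariant (m : probability (borel X) R) (f : X -> R) g :
  invariant_measure alpha m -> bounded_measurable f ->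
  \int[m]_x f (alpha g x) = \int[m]_x f x.
Proof.
move=> mI bf; have mg := act_measurable g.
have := @integral_pushforward _ _ (borel X) (borel X) R (alpha g) mg m setT (EFin \o f).
move=> /(_ _ _ measurableT).
rewrite preimage_setT => intE; rewrite /Rintegral; congr fine.
rewrite -[LHS]intE.
- by apply: eq_measure_integral => A mA _; exact: mI.
- by apply/measurable_EFinP; have [] := bf.
- exact/bounded_measurable_integrable/bounded_measurable_act.
Qed.

End invariant_integral.

(** * Invariant measures are close when orbits are dense up to r *)

Section dense_orbits.
Variables (R : realType) (G : topologicalGroupType) (X : pmetricType R).
Variable alpha : G -> X -> X.
Hypotheses (cX : compact [set: X]) (alpha_act : is_action alpha)
  (alpha_isom : isometric alpha).

(** An isometry is determined up to [d] by the positions, up to [d / 4], of the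
    images of a finite net: there are finitely many codes of such positions, and
    one group element is chosen for each. *)
Lemma isometric_net (d : R) : 0 < d -> exists gs : seq G,
  forall g, exists2 g', g' \in gs & forall x, mdist (alpha g x) (alpha g' x) <= d.
Proof.
move=> d0; have d40 : 0 < d / 4 by rewrite divr_gt0.
have [l lX] := compact_net cX d40.
have has_l x : has (fun y => mdist y x < d / 4) l.
  by apply/hasP; have [y yl yx] := lX x; exists y.
pose c (i : 'I_(size l)) := nth point l i.
pose near_ x := find (fun y => mdist y x < d / 4) l.
have near_P x : mdist (nth point l (near_ x)) x < d / 4.
  exact: nth_find (has_l x).
have near_lt x : (near_ x < size l)%N by rewrite -has_find.
pose code g : {ffun 'I_(size l) -> 'I_(size l)} :=
  [ffun i => Ordinal (near_lt (alpha g (c i)))].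
pose rep u :=
  if pselect (exists g, code g = u) is left h then sval (cid h) else 1%g.
exists [seq rep u | u <- enum {: {ffun 'I_(size l) -> 'I_(size l)}}] => g.
exists (rep (code g)); first by rewrite map_f// mem_enum.
have : code (rep (code g)) = code g.
  by rewrite /rep; case: pselect => [h|[]]; [exact: svalP (cid h)|exists g].
move: (rep _) => g' codeE x.
pose i := Ordinal (near_lt x).
have ix : mdist (c i) x < d / 4 by exact: near_P.
have ii : near_ (alpha g' (c i)) = near_ (alpha g (c i)).
  by have /ffunP/(_ i) := codeE; rewrite !ffunE => -[].
have := near_P (alpha g' (c i)); have := near_P (alpha g (c i)); rewrite ii.
set z := nth _ _ _ => zg zg'.
have g1 := metric_triangle (alpha g x) (alpha g (c i)) (alpha g' x).
have g2 := metric_triangle (alpha g (c i)) z (alpha g' x).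
have g3 := metric_triangle z (alpha g' (c i)) (alpha g' x).
move: g1 g2 g3; rewrite !alpha_isom (metric_sym x) (metric_sym _ z); lra.
Qed.

Variable r : R.
Hypothesis alpha_dense : forall x y, exists g, mdist (alpha g x) y <= r.

(** Discretise [mu] and [nu] by a partition of unity of mesh [s]. By density some
    [k a b] brings the centre [c b] within [r] of [c a], and the functions
    [I nu b j] of the group element are almost periodic because the action is
    isometric; [averaged_coupling] thus couples the discretisations at distance
    [r + 4 * s], and each of the two points adds another [s]. *)
Lemma wasserstein_dense_orbits (mu nu : probability (borel X) R) (p s : R) :
    1 <= p -> 0 < s -> invariant_measure alpha mu -> invariant_measure alpha nu ->
  (wasserstein p mu nu <= (r + 6 * s)%:E)%E.
Proof.
move=> p1 s0 muI nuI.
have [m [c [chi [L [L0 [chi_ge0 chi_sum chi_supp chi_lip]]]]]] :=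
  lipschitz_partition cX s0.
have r0 : 0 <= r.
  by have [g] := alpha_dense point point; apply: le_trans; exact: mdist_ge0.
have chi_1 i x : `|chi i x| <= 1 by rewrite ger0_norm// (chi_le1 chi_ge0 chi_sum).
have chi_bm i : bounded_measurable (chi i).
  by split; [exact: (lipschitz_measurable (chi_lip i))|exists 1].
have chi_act_bm i g := bounded_measurable_act alpha_isom g (chi_bm i).
have chi2_bm a i g : bounded_measurable (fun x => chi a x * chi i (alpha g x)).
  exact: bounded_measurableM.
have chi2_ge0 a i g x : 0 <= chi a x * chi i (alpha g x) by rewrite mulr_ge0.
pose I (m' : probability (borel X) R) a i g :=
  \int[m']_x (chi a x * chi i (alpha g x)).
have I_ge0 m' a i g : 0 <= I m' a i g by apply: Rintegral_ge0.
have I_row m' a g : \sum_i I m' a i g = \int[m']_x chi a x.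
  rewrite -Rintegral_sum//; apply: eq_Rintegral => x _.
  by rewrite -mulr_sumr chi_sum mulr1.
have I_col m' i g : invariant_measure alpha m' ->
    \sum_a I m' a i g = \int[m']_x chi i x.
  move=> m'I; rewrite -(Rintegral_invariant alpha_isom g m'I (chi_bm i)).
  rewrite -Rintegral_sum//; apply: eq_Rintegral => x _.
  by rewrite -mulr_suml chi_sum mul1r.
have I_sum1 (m' : probability (borel X) R) : \sum_i \int[m']_x chi i x = 1.
  rewrite -Rintegral_sum// (@eq_Rintegral _ _ _ m' setT (cst 1)); last first.
    by move=> x _; exact: chi_sum.
  by rewrite Rintegral_cst// [X in fine X](probability_setT m') mulr1.
have I_net b j eta : 0 < eta -> exists gs, right_net gs eta (I nu b j).
  move=> eta0; have d0 : 0 < eta / (L + 1) by rewrite divr_gt0// ltr_wpDl.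
  have [gs gsP] := isometric_net d0; exists gs => g.
  have [g' g'gs gg'] := gsP g; exists g' => // h.
  rewrite /I -RintegralB//; [|exact/bounded_measurable_integrable..].
  apply: le_norm_Rintegral => [|x]; first exact: bounded_measurableB.
  rewrite -mulrBr normrM -[leRHS]mul1r; apply: ler_pM => //.
  apply: le_trans (chi_lip _ _ _) _; rewrite !alpha_act.2 alpha_isom.
  apply: (@le_trans _ _ ((L + 1) * (eta / (L + 1)))); last first.
    by rewrite mulrC divfK// gt_eqF// ltr_wpDl.
  by apply: ler_pM => //; [exact: mdist_ge0|rewrite lerDl].
have [k kP] : exists k : 'I_m -> 'I_m -> G,
    forall a b, mdist (c a) (alpha (k a b) (c b)) <= r.
  have kk (a b : 'I_m) : exists g, mdist (c a) (alpha g (c b)) <= r.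
    by have [g] := alpha_dense (c b) (c a); rewrite metric_sym; exists g.
  by exists (fun a b => sval (cid (kk a b))) => a b; exact: svalP (cid (kk a b)).
have [|w [w_ge0 w_row w_col w_rel]] := @averaged_coupling R G 'I_m
    (fun i => \int[mu]_x chi i x) (fun i => \int[nu]_x chi i x) (I mu) (I nu) k
    (fun i j => mdist (c i) (c j) <= r + 4 * s) (I_ge0 mu) (I_ge0 nu) (I_row mu)
    (fun i g => I_col mu i g muI) (I_row nu) (fun i g => I_col nu i g nuI)
    (I_sum1 mu) (I_sum1 nu) I_net.
  move=> a b i j h /Rintegral_neq0[x] + /Rintegral_neq0[y].
  rewrite !mulf_eq0 !negb_or => /andP[/chi_supp ax /chi_supp ihx].
  move=> /andP[/chi_supp bY /chi_supp jy].
  rewrite alpha_act.2 in jy.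
  have t1 := metric_triangle (c i) (alpha h x) (c j).
  have t2 := metric_triangle (alpha h x) (alpha h (c a)) (c j).
  have t3 := metric_triangle (alpha h (c a)) (alpha h (alpha (k a b) (c b))) (c j).
  have t4 := metric_triangle (alpha h (alpha (k a b) (c b)))
    (alpha h (alpha (k a b) y)) (c j).
  have := kP a b.
  move: t1 t2 t3 t4; rewrite !alpha_isom (metric_sym x).
  by rewrite (metric_sym (alpha h (alpha (k a b) y))); lra.
(* points weighted together lie within s of two centres related by w *)
have [|pi [pi_cpl pi_supp]] := exists_weighted_coupling cX (mu := mu)
    (nu := nu) chi_ge0 chi_sum (fun i => (chi_bm i).1)
    w_ge0 w_row w_col (D := r + 6 * s).
  move=> i j x y /w_rel ij /chi_supp ix /chi_supp jy.
  have := metric_triangle x (c i) y; have := metric_triangle (c i) (c j) y.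
  by rewrite (metric_sym x (c i)); lra.
by apply: wasserstein_le pi_cpl pi_supp => //; rewrite addr_ge0// mulr_ge0// ltW.
Qed.

End dense_orbits.

(** * Gromov-Hausdorff approximations of actions *)

Section approximations.
Variables (R : realType) (G : topologicalGroupType).

Lemma GHA_equivariant (X Y : metricType R) (e : R) (alpha : G -> X -> X)
    (beta : G -> Y -> Y) (f : X -> Y) : GHA e alpha beta f ->
  forall g x, mdist (beta g (f x)) (f (alpha g x)) <= e.
Proof.
move=> [_ fe] g x; rewrite -lee_fin; apply: le_trans (fe g).
by apply: ereal_sup_ubound; exists x.
Qed.

(** Compare the distance of the images under [alpha g] with that of the images
    under [beta g] through [f]: two equivariance and two distortion errors. *)
Lemma GHA_isometric_defect (X Y : metricType R) (e : R) (alpha : G -> X -> X)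
    (beta : G -> Y -> Y) (f : X -> Y) : GHA e alpha beta f -> isometric beta ->
  forall g x y, `|mdist (alpha g x) (alpha g y) - mdist x y| <= 4 * e.
Proof.
move=> fG betaI g x y; have fe := fG.1.1.
have := mdist_quadrangle (beta g (f x)) (f (alpha g x))
  (beta g (f y)) (f (alpha g y)).
have := fe (alpha g x) (alpha g y); have := fe x y; rewrite betaI.
have := GHA_equivariant fG g x; have := GHA_equivariant fG g y.
rewrite !ler_norml => ? ? /andP[? ?] /andP[? ?] /andP[? ?].
by apply/andP; split; lra.
Qed.

(** Pull back along [f] an element of the group that moves [f x] close to [f y]. *)
Lemma GHA_dense_orbits (X Y : metricType R) (e : R) (alpha : G -> X -> X)
    (beta : G -> Y -> Y) (f : X -> Y) : 0 < e -> GHA e alpha beta f ->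
    (forall x y (d : R), 0 < d -> exists g, mdist (beta g x) y < d) ->
  forall x y, exists g, mdist (alpha g x) y <= 3 * e.
Proof.
move=> e0 fG dense x y; have [g gxy] := dense (f x) (f y) e e0; exists g.
have := fG.1.1 (alpha g x) y; rewrite ler_norml => /andP[h _].
have := GHA_equivariant fG g x; rewrite metric_sym.
by have := metric_triangle (f (alpha g x)) (beta g (f x)) (f y); lra.
Qed.

Lemma dGH_lt (X Y : metricType R) (alpha : G -> X -> X) (beta : G -> Y -> Y) (e : R) :
  (dGH alpha beta < e%:E)%E -> exists2 d, 0 < d < e &
    (exists f, GHA d alpha beta f) /\ (exists f, GHA d beta alpha f).
Proof.
move=> /ereal_inf_lt[_ [d [d0 fd gd] <-]]; rewrite lte_fin => de.
by exists d => //; rewrite d0.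
Qed.

Lemma wasserstein_diam_le (X : pmetricType R) (p D : R)
    (S : set (probability (borel X) R)) : 0 <= D ->
    (forall mu nu, S mu -> S nu -> (wasserstein p mu nu <= D%:E)%E) ->
  (wasserstein_diam p S <= D%:E)%E.
Proof.
move=> D0 SD; rewrite /wasserstein_diam ge_max lee_fin D0 /=.
by apply: ge_ereal_sup => _ [[mu nu] [Smu Snu] <-]; exact: SD.
Qed.

Lemma ereal_cvg0 (u : nat -> \bar R) : (forall n, 0 <= u n)%E ->
  (forall e : R, 0 < e -> \forall n \near \oo, (u n <= e%:E)%E) -> u @ \oo --> 0%E.
Proof.
move=> u0 ue; apply/fine_cvgP; split.
  near=> n; rewrite ge0_fin_numE//; apply: (@le_lt_trans _ _ 1%E); last exact: ltry.
  by near: n; exact: (ue 1 ltr01).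
apply/cvgrPdist_le => e e0; near=> n.
have : (u n <= e%:E)%E by near: n; exact: ue.
have := u0 n; rewrite /= sub0r normrN; case: (u n) => [r| |] //=.
by rewrite !lee_fin => r0 re; rewrite ger0_norm.
Unshelve. all: by end_near. Qed.

End approximations.

(** * Convergence of the diameters *)

Unset Implicit Arguments.

Theorem corollary1p4 (R : realType) (G : topologicalGroupType)
  (X_ : nat -> pmetricType R) (alpha_ : forall n, G -> X_ n -> X_ n)
  (X : pmetricType R) (alpha : G -> X -> X)
  (G_lc : locally_compact_group G) (G_sc : sigma_compact G)
  (G_am : amenable R G)
  (Xn_compact : forall n, compact [set: X_ n])
  (alpha_cont : forall n, continuous_action (alpha_ n))
  (alpha_isom : forall n, isometric (alpha_ n))
  (X_compact : compact [set: X])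
  (alpha_act : is_action alpha)
  (alpha_lim : (fun n => dGH (alpha_ n) alpha) @ \oo --> 0%E)
  (alpha_ue : uniquely_ergodic alpha) :
  forall p : R, 1 <= p ->
    (fun n => wasserstein_diam p [set mu | invariant_measure (alpha_ n) mu])
      @ \oo --> 0%E.
Proof.
move=> p p1.
have near_dGH e : 0 < e -> \forall n \near \oo, (dGH (alpha_ n) alpha < e%:E)%E.
  move=> e0; have /alpha_lim : nbhs (0%E : \bar R) [set z | (z < e%:E)%E].
    by apply: open_ereal_lt'; rewrite lte_fin.
  by [].
(* alpha is approximated arbitrarily well by isometric actions *)
have alphaI : isometric alpha.
  move=> g x y; apply/eqP; rewrite -subr_eq0 -normr_le0.
  apply/ler_addgt0Pl => e e0; rewrite addr0.
  have e40 : 0 < e / 4 by rewrite divr_gt0.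
  have [n _ /(_ n (leqnn n)) /dGH_lt[d /andP[d0 de] [_ [h hG]]]] := near_dGH _ e40.
  by apply: le_trans (GHA_isometric_defect hG (alpha_isom n) g x y) _; lra.
have dense := uniquely_ergodic_dense alpha_act alphaI X_compact alpha_ue.
apply: ereal_cvg0 => [n|e e0]; first by rewrite le_max lexx.
have e60 : 0 < e / 6 by rewrite divr_gt0.
near=> n.
have /dGH_lt[d /andP[d0 de] [[f fG] _]] : (dGH (alpha_ n) alpha < (e / 6)%:E)%E.
  by near: n; exact: near_dGH.
apply: wasserstein_diam_le => [|mu nu muI nuI]; first exact: ltW.
(* the orbits are 3 * d-dense with d < e / 6, and 6 * (e / 12) = e / 2 *)
have s0 : 0 < e / 12 by rewrite divr_gt0.
apply: le_trans (wasserstein_dense_orbits (Xn_compact n) (alpha_cont n).1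
  (alpha_isom n) (GHA_dense_orbits d0 fG dense) p1 s0 muI nuI) _.
by rewrite lee_fin; lra.
Unshelve. all: by end_near. Qed.
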